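(* Let $X$ be a locally finite connected primitive graph with infinitely many ends. Then $G=\mathrm{Aut}(X)$ has an open topologically simple subgroup of finite index.
   Context: Graphs are simple and undirected, with vertex set $VX$; locally finite means every vertex has finite degree. A ray is a sequence $(v_i)_{i\in\mathbf{N}}$ of distinct vertices with $v_i$ adjacent to $v_{i+1}$ for all $i$. Two rays are equivalent if there is a third ray containing infinitely many vertices from both of them; an end of $X$ is an equivalence class of rays. A graph $X$ is primitive if $\mathrm{Aut}(X)$ acts transitively on $VX$ and the only $\mathrm{Aut}(X)$-invariant equivalence relations on $VX$ are the trivial one (all classes are singletons) and the universal one (only one class). $G=\mathrm{Aut}(X)$ carries the permutation topology from its action on $VX$, in which the pointwise stabilizers of finite subsets of $VX$ form a neighbourhood basis of the identity. A topological group is topologically simple if its only closed normal subgroups are the trivial subgroup and the whole group; subgroups carry the induced topology. *)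

(* Defs.v *)
From Stdlib Require Import Relations.
From HB Require Import structures.
From mathcomp Require Import all_boot.
From mathcomp Require Import all_classical.
From mathcomp Require Import topology.

Set Implicit Arguments.
Unset Strict Implicit.
Unset Printing Implicit Defensive.

Local Open Scope classical_set_scope.
Local Open Scope group_scope.

(* Adjacency is a Prop-valued relation and the vertex type is arbitrary:
   graphs here are usually infinite. *)
Record graph := Graph {
  vertex :> Type;
  adj : vertex -> vertex -> Prop;
  adj_sym : forall x y, adj x y -> adj y x;
  adj_irrefl : forall x, ~ adj x x
}.

Definition locally_finite (X : graph) : Prop :=
  forall x : X, finite_set [set y | adj x y].

Definition graph_connected (X : graph) : Prop :=
  forall x y : X, clos_refl_trans X (@adj X) x y.

Definition is_ray (X : graph) (v : nat -> X) : Prop :=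
  injective v /\ forall i, adj (v i) (v i.+1).

Definition ray_equiv (X : graph) (r s : nat -> X) : Prop :=
  exists t : nat -> X, [/\ is_ray t,
    infinite_set (range t `&` range r) &
    infinite_set (range t `&` range s)].

Definition ends (X : graph) : set (set (nat -> X)) :=
  [set [set s | is_ray s /\ ray_equiv r s] | r in [set r | is_ray r]].

Arguments ends : clear implicits.

Record aut (X : graph) := Aut {
  aut_fun :> X -> X;
  aut_bij : bijective aut_fun;
  aut_adj : forall x y, adj (aut_fun x) (aut_fun y) <-> adj x y
}.

HB.instance Definition _ (X : graph) := gen_eqMixin (aut X).
HB.instance Definition _ (X : graph) := gen_choiceMixin (aut X).

Definition primitive (X : graph) : Prop :=
  (forall x y : X, exists g : aut X, g x = y) /\
  (forall R : X -> X -> Prop,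
     equivalence X R ->
     (forall (g : aut X) x y, R x y <-> R (g x) (g y)) ->
     (forall x y, R x y <-> x = y) \/ (forall x y, R x y)).

Section AutGroup.
Variable X : graph.
Implicit Types g h k : aut X.

Lemma autP g h : g =1 h -> g = h.
Proof.
case: g h => [f fb fa] [f' fb' fa'] /= /funext e.
by subst f'; congr Aut; exact: Prop_irrelevance.
Qed.

Lemma aut_one_adj (x y : X) : adj (id x) (id y) <-> adj x y.
Proof. by []. Qed.

Definition aut_one : aut X :=
  @Aut X id (Bijective (fun=> erefl) (fun=> erefl)) aut_one_adj.

Lemma aut_mul_adj g h (x y : X) : adj ((g \o h) x) ((g \o h) y) <-> adj x y.
Proof. by rewrite /= !aut_adj. Qed.

Definition aut_mul g h : aut X :=
  Aut (bij_comp (aut_bij g) (aut_bij h)) (@aut_mul_adj g h).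

Lemma aut_inv_ex g : exists f : X -> X, cancel g f /\ cancel f g.
Proof. by case: (aut_bij g) => f; exists f. Qed.

Definition aut_invf g : X -> X := sval (cid (aut_inv_ex g)).

Lemma aut_invfK g : cancel g (aut_invf g).
Proof. by rewrite /aut_invf; case: cid => f /= []. Qed.

Lemma aut_invfKV g : cancel (aut_invf g) g.
Proof. by rewrite /aut_invf; case: cid => f /= []. Qed.

Lemma aut_inv_adj g (x y : X) :
  adj (aut_invf g x) (aut_invf g y) <-> adj x y.
Proof. by rewrite -(aut_adj g) !aut_invfKV. Qed.

Definition aut_inv g : aut X :=
  Aut (Bijective (aut_invfKV g) (@aut_invfK g)) (@aut_inv_adj g).

Lemma aut_mulA : associative aut_mul.
Proof. by move=> g h k; exact: autP. Qed.

Lemma aut_mul1 : left_id aut_one aut_mul.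
Proof. by move=> g; exact: autP. Qed.

Lemma aut_mulr1 : right_id aut_one aut_mul.
Proof. by move=> g; exact: autP. Qed.

Lemma aut_mulV : left_inverse aut_one aut_inv aut_mul.
Proof. by move=> g; apply: autP => x /=; exact: aut_invfK. Qed.

Lemma aut_mulrV : right_inverse aut_one aut_inv aut_mul.
Proof. by move=> g; apply: autP => x /=; exact: aut_invfKV. Qed.

HB.instance Definition _ := isGroup.Build (aut X)
  aut_mulA aut_mul1 aut_mulr1 aut_mulV aut_mulrV.

Lemma aut_mulE g h x : (g * h) x = g (h x).
Proof. by []. Qed.

Lemma aut_invK g x : g^-1 (g x) = x.
Proof. exact: aut_invfK. Qed.

Lemma aut_invKV g x : g (g^-1 x) = x.
Proof. exact: aut_invfKV. Qed.

Definition pstab (S : set X) : set (aut X) :=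
  [set g | forall x, S x -> g x = x].

(* Permutation topology: the cosets g * pstab S, for S finite, are a
   neighbourhood basis at g. *)
Definition aut_nbhs g : set_system (aut X) :=
  [set A | exists2 S, finite_set S & [set g * h | h in pstab S] `<=` A].

HB.instance Definition _ := hasNbhs.Build (aut X) aut_nbhs.

Lemma aut_nbhsP g (A : set (aut X)) :
  nbhs g A <->
  exists2 S : set X, finite_set S &
    forall h, (forall x, S x -> h x = g x) -> A h.
Proof.
split=> -[S finS SA]; exists S => // h.
- move=> hg; apply: SA; exists (g^-1 * h); last by rewrite mulgA mulgV mul1g.
  by move=> x Sx; rewrite aut_mulE hg // aut_invK.
- by move=> [k kS <-]; apply: SA => x Sx; rewrite aut_mulE kS.
Qed.

Lemma aut_nbhs_filter g : ProperFilter (nbhs g).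
Proof.
apply: Build_ProperFilter_ex.
  by move=> A /aut_nbhsP[S _ SA]; exists g; exact: SA.
split.
- by apply/aut_nbhsP; exists set0.
- move=> A B /aut_nbhsP[S fS SA] /aut_nbhsP[T fT TB].
  apply/aut_nbhsP; exists (S `|` T); first by rewrite finite_setU.
  by move=> h hg; split; [apply: SA|apply: TB] => x ?; apply: hg; [left|right].
- move=> A B AB /aut_nbhsP[S fS SA]; apply/aut_nbhsP; exists S => // h /SA.
  exact: AB.
Qed.

Lemma aut_nbhs_singleton g (A : set (aut X)) : nbhs g A -> A g.
Proof. by move=> /aut_nbhsP[S _ SA]; exact: SA. Qed.

Lemma aut_nbhs_nbhs g (A : set (aut X)) : nbhs g A -> nbhs g (nbhs^~ A).
Proof.
move=> /aut_nbhsP[S fS SA]; apply/aut_nbhsP; exists S => // h hg.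
apply/aut_nbhsP; exists S => // k kh; apply: SA => x Sx.
by rewrite kh // hg.
Qed.

HB.instance Definition _ := Nbhs_isNbhsTopological.Build (aut X)
  aut_nbhs_filter aut_nbhs_singleton aut_nbhs_nbhs.

End AutGroup.

HB.mixin Record isTopologicalGroup G & Topological G & Group G := {
  mulg_continuous : continuous (fun x : G * G => x.1 * x.2);
  invg_continuous : continuous (fun x : G => x^-1)
}.

#[short(type="topologicalGroupType")]
HB.structure Definition TopologicalGroup :=
  { G of Topological G & Group G & isTopologicalGroup G }.

Section AutTopologicalGroup.
Variable X : graph.

Lemma aut_mulg_continuous : continuous (fun x : aut X * aut X => x.1 * x.2).
Proof.
move=> [g h] A /= /aut_nbhsP[S fS SA].
exists ([set g' : aut X | forall x, [set h z | z in S] x -> g' x = g x],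
        [set h' : aut X | forall x, S x -> h' x = h x]) => /=.
  split; apply/aut_nbhsP; last by exists S.
  by exists [set h z | z in S] => //; exact: finite_image.
move=> [g' h'] /= [g'E h'E]; apply: SA => x Sx.
by rewrite !aut_mulE h'E // g'E //; exists x.
Qed.

Lemma aut_invg_continuous : continuous (fun g : aut X => g^-1).
Proof.
move=> g A /= /aut_nbhsP[S fS SA]; apply/aut_nbhsP.
exists [set g^-1 z | z in S]; first exact: finite_image.
move=> h hg; apply: SA => x Sx.
by rewrite -[in LHS](aut_invKV g x) -hg ?aut_invK //; exists x.
Qed.

HB.instance Definition _ := isTopologicalGroup.Build (aut X)
  aut_mulg_continuous aut_invg_continuous.

End AutTopologicalGroup.

Section Subgroups.
Variable G : topologicalGroupType.
Implicit Types N H : set G.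

Definition subgroup H : Prop := group_closed (mem H).

Definition normal_in N H : Prop :=
  N `<=` H /\ forall h n, H h -> N n -> N (n ^ h).

(* Closedness of N is taken in the induced topology on H. *)
Definition topologically_simple H : Prop :=
  forall N : set G, subgroup N -> normal_in N H ->
    closed (N : set (subspace H)) -> N = [set 1] \/ N = H.

Definition finite_index H : Prop :=
  finite_set [set [set g * h | h in H] | g in [set: G]].

End Subgroups.

(* Main.v *)
Require Import Defs.
From mathcomp Require Import all_boot finmap all_classical topology.
From mathcomp.zify Require Import zify.

Set Implicit Arguments.
Unset Strict Implicit.
Unset Printing Implicit Defensive.

Local Open Scope classical_set_scope.
Local Open Scope group_scope.

(** Infinitely many ends yield a finite connected set [F] whose removal leaves
at least four components, all of them infinite ([separator_ex]).  The rest is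
ping-pong with the translates of [F].  An automorphism that moves [F] off itself
carries it into some component [b], while its inverse carries it into some
component [a]; call it an arrow from [a] to [b].  An arrow from [a] to [b] sends
every component other than [a] into [b] ([arrow_map]), so an arrow from [a] to
[b] followed by an arrow from [c] to [d] is an arrow from [a] to [d] as soon as
[b <> c] ([arrow_comp]).  This calculus replaces the action on a structure tree.

Primitivity enters in three ways.

- The orbits of a normal subgroup are blocks, so a nontrivial normal subgroup is
  transitive ([normal_vtransitive]); hence a nontrivial automorphism has
  unbounded displacement ([unbounded_displacement]).

- No end is fixed.  For a component [D], the number of translates of [D] that
  contain [x] and omit [y], minus the number of those that contain [y] and omit
  [x], is an invariant cocycle with integer values; where it vanishes is an
  invariant equivalence relation, and in fact it vanishes everywhere
  ([balanced_all]).  Were the translates of [D] all to face the same end, this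
  balance would fail along the axis of an arrow; so some translates of [D] are
  disjoint ([disjoint_translates]), and then a nontrivial normal subgroup
  contains arrows between any two components ([normal_arrow_ex]).

- Point stabilisers are maximal ([stabiliser_maximal]).  If a finite set had a
  trivial pointwise stabiliser, then a finite point stabiliser together with a
  suitable arrow would generate a free product all of whose nontrivial elements
  move [F] off itself ([ping_pong]): a proper, larger subgroup.  So pointwise
  stabilisers of finite sets are nontrivial ([pstab_nontrivial]).

The required subgroup, the [monolith], is generated by the conjugates of the
automorphisms that fix [F] and one component of its complement pointwise.  As an
automorphism that fixes [F] pointwise acts independently on the components that
it preserves, fixing [F] and one further vertex already puts it in the monolith
([pstab_monolith]).  Hence the monolith is open and nontrivial, thus transitive,
and of finite index because the orbits of a point stabiliser are finite.  A
nontrivial normal subgroup of the monolith again contains arrows between any two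
components ([normal_arrow]), and Tits' commutator argument then puts every
generator of the monolith into it ([rist_normal]). *)

(** * Connected sets, components and balls *)

Section Connectivity.
Variable X : graph.
Implicit Types (F Q D E : set X) (g : aut X).

(** Connectedness of the subgraph induced on [Q], in the form of an induction
principle: a set that meets [Q] and is closed under the adjacencies of [Q]
contains [Q].  The empty set counts as connected. *)
Definition gconn Q := forall A : set X, (exists2 u, Q u & A u) ->
  (forall u v, A u -> Q u -> Q v -> adj u v -> A v) -> Q `<=` A.

Definition component F D :=
  [/\ D !=set0, forall u, D u -> ~ F u,
      forall u v, D u -> adj u v -> ~ F v -> D v & gconn D].

(** The component of [u] is the least set around [u] closed under adjacency
outside [F].  A set closed in it and meeting it contains [u], for otherwise its
complement would be a smaller such set, adjacency being symmetric. *)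
Lemma component_ex F u : ~ F u -> exists2 D, component F D & D u.
Proof.
move=> Fu.
pose cl (A : set X) := forall a b, A a -> adj a b -> ~ F b -> A b.
pose D := [set v | forall A : set X, A u -> cl A -> A v].
have Du : D u by move=> A.
have Dcl : cl D by move=> a b Da ab Fb A Au Acl; apply: (Acl a) => //; exact: Da.
have DF v : D v -> ~ F v by move=> /(_ (~` F) Fu); apply; move=> a b _ _.
exists D => //; split=> //; first by exists u.
move=> A [w Dw Aw] Acl.
have Au : A u.
  apply: contrapT => NAu.
  suff /(_ w Dw)[] : D `<=` D `\` A by [].
  move=> v /(_ (D `\` A)); apply; first by split.
  move=> a b [Da NAa] ab Fb; have Db := Dcl _ _ Da ab Fb.
  by split=> // Ab; apply: NAa; apply: (Acl b) => //; exact: adj_sym.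
move=> v /(_ (D `&` A)) DA; apply DA => // a b [Da Aa] ab Fb.
by have Db := Dcl _ _ Da ab Fb; split=> //; exact: (Acl a).
Qed.

Lemma gconn_sub_component F D Q u : component F D -> gconn Q ->
  (forall v, Q v -> ~ F v) -> Q u -> D u -> Q `<=` D.
Proof.
move=> [_ _ Dcl _] cQ QF Qu Du; apply: cQ; first by exists u.
by move=> a b Da Qa Qb ab; apply: (Dcl a) => //; exact: QF.
Qed.

Lemma component_eq F D E u :
  component F D -> component F E -> D u -> E u -> D = E.
Proof.
move=> cD cE Du Eu; apply/seteqP.
have [_ DF _ Dc] := cD; have [_ EF _ Ec] := cE.
by split; [apply: (gconn_sub_component cE Dc DF Du Eu)
  |apply: (gconn_sub_component cD Ec EF Eu Du)].
Qed.

Lemma gconn_adjU Q D u v : gconn Q -> gconn D -> Q u -> D v -> adj u v ->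
  gconn (Q `|` D).
Proof.
move=> cQ cD Qu Dv uv A [w QDw Aw] Acl.
have vu := adj_sym uv.
have QA w' : Q w' -> A w' -> Q `<=` A.
  move=> Qw Aw'; apply: cQ; first by exists w'.
  by move=> a b Aa Qa Qb; apply: Acl => //; left.
have DA w' : D w' -> A w' -> D `<=` A.
  move=> Dw Aw'; apply: cD; first by exists w'.
  by move=> a b Aa Da Db; apply: Acl => //; right.
case: QDw => [Qw|Dw] z [Qz|Dz].
- exact: (QA w).
- by apply: (DA v) => //; apply: (Acl u) => //; [exact: (QA w)|left|right].
- by apply: (QA u) => //; apply: (Acl v) => //; [exact: (DA w)|right|left].
- exact: (DA w).
Qed.

Definition translate g Q : set X := [set u | Q (g^-1 u)].

Lemma translateE g Q u : translate g Q (g u) <-> Q u.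
Proof. by rewrite /translate /mkset aut_invK. Qed.

Lemma gconn_translate g Q : gconn Q -> gconn (translate g Q).
Proof.
move=> cQ A [u Qu Au] Acl v Qv.
have {Qv} : Q (g^-1 v) := Qv.
rewrite -(aut_invKV g v) aut_invK; move: (g^-1 v); apply: (cQ (fun w => A (g w))).
  by exists (g^-1 u); rewrite ?aut_invKV.
by move=> a b Aa Qa Qb ab; apply: (Acl (g a)); rewrite ?translateE ?aut_adj.
Qed.

Lemma component_translate g F D : component F D ->
  component (translate g F) (translate g D).
Proof.
move=> [[u Du] DF Dcl cD]; split; last exact: gconn_translate.
- by exists (g u); rewrite translateE.
- by move=> v; exact: DF.
- by move=> a b Da ab; apply: Dcl Da _; rewrite aut_adj.
Qed.

Lemma finite_bound (T : Type) (S : set T) (r : T -> nat) : finite_set S ->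
  exists n, forall v, S v -> (r v <= n)%N.
Proof.
move=> fS; have /finite_seqP[s sP] : finite_set (r @` S) by exact: finite_image.
exists (\max_(n <- s) n) => v Sv.
have : [set` s] (r v) by rewrite -sP; exists v.
by move=> /= vs; rewrite (big_rem _ vs) /= leq_maxl.
Qed.

Fixpoint gball n x : set X :=
  if n is n'.+1 then
    [set v | gball n' x v \/ exists2 u, gball n' x u & adj u v]
  else [set x].

Lemma gball_center n x : gball n x x.
Proof. by elim: n => [|n IH] //=; left. Qed.

Lemma gball_gconn n x : gconn (gball n x).
Proof.
elim: n => [|n IH] A /=; first by move=> [u -> Ax] _ v ->.
move=> [u ux Au] Acl.
have BA w : gball n x w -> A w -> gball n x `<=` A.
  move=> Bw Aw; apply: IH; first by exists w.
  by move=> a b Aa Ba Bb; apply: Acl => //; left.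
have {}BA : gball n x `<=` A.
  case: ux => [ux|[w Bw wu]]; first exact: (BA u).
  apply: (BA w) => //; apply: (Acl u) => //; first by right; exists w.
    by left.
  exact: adj_sym.
move=> v [Bv|[w Bw wv]]; first exact: BA.
by apply: (Acl w) => //; [exact: BA|left|right; exists w].
Qed.

Lemma gball_trans m n x y z : gball m x y -> gball n y z -> gball (m + n) x z.
Proof.
elim: n z => [|n IH] z xy /=; first by move=> ->; rewrite addn0.
by rewrite addnS => -[/(IH _ xy)|[u /(IH _ xy) xu uz]] /=; [left|right; exists u].
Qed.

Lemma gball_leq m n x : (m <= n)%N -> gball m x `<=` gball n x.
Proof.
by move=> mn v xv; rewrite -(subnKC mn); apply: gball_trans xv (gball_center _ _).
Qed.

Lemma gball_sym n x y : gball n x y -> gball n y x.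
Proof.
elim: n y => [|n IH] y /=; first by move=> ->.
move=> [/IH|[u /IH ux uy]]; first by left.
rewrite -[gball n y x \/ _]/(gball n.+1 y x) -add1n; apply: gball_trans ux => /=.
by right; exists y => //; exact: adj_sym.
Qed.

Lemma gball_aut n g x y : gball n (g x) (g y) <-> gball n x y.
Proof.
have im (h : aut X) a b : gball n a b -> gball n (h a) (h b).
  elim: n b => [|n IH] b /=; first by move=> ->.
  by move=> [/IH|[u /IH au ub]]; [left|right; exists (h u) => //; rewrite aut_adj].
by split=> [/(im g^-1)|/im//]; rewrite !aut_invK.
Qed.

Hypothesis Xlf : locally_finite X.
Hypothesis Xconn : graph_connected X.

Lemma gball_finite n x : finite_set (gball n x).
Proof.
elim: n => [|n IH] /=; first exact: finite_set1.
suff -> : [set v | gball n x v \/ exists2 u, gball n x u & adj u v] =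
  gball n x `|` \bigcup_(u in gball n x) [set v | adj u v].
  by rewrite finite_setU; split=> //; apply: bigcup_finite => // u _; exact: Xlf.
by apply/seteqP; split=> v /= [|[u]]; [left|right; exists u|left|right; exists u].
Qed.

Lemma gball_ex x y : exists n, gball n x y.
Proof.
elim: (Xconn x y) => {x y} [x y xy|x|x y z _ [m xy] _ [n yz]].
- by exists 1%N; right; exists x.
- by exists 0%N.
- by exists (m + n)%N; exact: gball_trans xy yz.
Qed.

Lemma finite_sub_gball (S : set X) x : finite_set S ->
  exists n, S `<=` gball n x.
Proof.
have [r rP] := choice (gball_ex x).
move=> fS; have [n Sn] := finite_bound r fS.
by exists n => v Sv; apply: gball_leq (rP v); exact: Sn.
Qed.

Lemma gconnT : gconn [set: X].
Proof.
move=> A [u _ Au] Acl v _.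
elim: (Xconn u v) Au => {u v} [x y xy Ax|//|x y z _ IH _ IH' /IH/IH' //].
exact: (Acl x).
Qed.

(** A component without neighbours in [F] would be the whole connected graph. *)
Lemma component_adj F D : component F D -> F !=set0 ->
  exists u v, [/\ D u, F v & adj u v].
Proof.
move=> [[w Dw] DF Dcl _] [f Ff]; apply: contrapT => H.
suff : D f by move=> /DF.
apply: (@gconnT D) => //; first by exists w.
move=> u v Du _ _ uv; apply: (Dcl u) => // Fv; apply: H.
by exists u, v.
Qed.

Lemma component_gconnU F D : component F D -> gconn F -> F !=set0 ->
  gconn (D `|` F).
Proof.
move=> cD cF F0; have [u [v [Du Fv uv]]] := component_adj cD F0.
by have [_ _ _ Dc] := cD; exact: gconn_adjU uv.
Qed.

(* An infinite set has points far away from any given finite set. *)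
Lemma infinite_far (A S : set X) n : infinite_set A -> finite_set S ->
  exists2 v, A v & forall u, S u -> ~ gball n u v.
Proof.
move=> iA fS; apply: contrapT => H; apply: iA.
apply: (@sub_finite_set _ _ (\bigcup_(u in S) gball n u)); last first.
  by apply: bigcup_finite => // u _; exact: gball_finite.
move=> v Av; apply: contrapT => Hv; apply: H; exists v => // u Su uv.
by apply: Hv; exists u.
Qed.

End Connectivity.


(** * Arrows between the components of a separator *)

(** The last field is how four components are used: there is always one that
avoids three given ones.  The second vertex of [F] serves to recognise a group
that moves [F] off itself as intransitive. *)
Record separator (X : graph) (F : set X) (x0 : X) : Prop := Separator {
  sep_finite : finite_set F;
  sep_gconn : gconn F;
  sep_base : F x0;
  sep_two : exists2 x1, F x1 & x1 <> x0;
  sep_infinite : forall D, component F D -> infinite_set D;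
  sep_four : forall a b c : set X,
    exists d, [/\ component F d, d <> a, d <> b & d <> c]
}.

(** The notions of subgroup and normality used inside the proof are stated with
bare membership and left conjugation; they are matched with the official ones in
[simple_open_finite_index]. *)
Record is_subgroup (X : graph) (N : set (aut X)) : Prop := IsSubgroup {
  sg1 : N 1;
  sgM : forall g h, N g -> N h -> N (g * h);
  sgV : forall g, N g -> N g^-1
}.

Definition normalised (X : graph) (N H : set (aut X)) :=
  forall h n, H h -> N n -> N (h * n * h^-1).

Definition vtransitive (X : graph) (P : set (aut X)) :=
  forall x y : X, exists2 g, P g & g x = y.

Section Arrows.
Variable X : graph.
Hypothesis Xlf : locally_finite X.
Hypothesis Xconn : graph_connected X.
Variables (F : set X) (x0 : X).
Hypothesis sepF : separator F x0.
Implicit Types (a b c d e D : set X) (g h p q : aut X) (N P H : set (aut X)).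

Let F0 : F !=set0. Proof. by exists x0; exact: sep_base sepF. Qed.

Definition arrow a b g := [/\ component F a, component F b,
  forall f, F f -> b (g f) & forall f, F f -> a (g^-1 f)].

Lemma arrowV a b g : arrow a b g -> arrow b a g^-1.
Proof. by move=> [? ? ? ?]; split=> //; rewrite invgK. Qed.

(** [e] together with [F] is connected and misses the preimage of [F], which
lies in [c]; so its image is connected, misses [F], and meets [d]. *)
Lemma arrow_map c d e q : arrow c d q -> component F e -> e <> c ->
  forall v, (e `|` F) v -> d (q v).
Proof.
move=> [cc cd qF qVF] ce ec.
have [_ dF dcl _] := cd; have [_ eF _ _] := ce; have [_ cF _ _] := cc.
apply: (component_gconnU Xconn ce (sep_gconn sepF) F0).
  by have Fx := sep_base sepF; exists x0; [right|exact: qF].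
move=> u v du _ efv uv; apply: (dcl (q u)) => //; first by rewrite aut_adj.
move=> Fqv; have := qVF _ Fqv; rewrite aut_invK => cv.
case: efv => [ev|/(cF _ cv)//].
by apply: ec; exact: component_eq ce cc ev cv.
Qed.

Lemma arrow_mapC c d e q : arrow c d q -> component F e -> e <> c ->
  forall v, e v -> d (q v).
Proof. by move=> qa ce ec v ev; apply: (arrow_map qa ce ec); left. Qed.

Lemma arrow_comp a b c d p q :
  arrow a b p -> arrow c d q -> b <> c -> arrow a d (q * p).
Proof.
move=> pa qa bc; have [ca cb pF _] := pa; have [cc cd _ qVF] := qa.
split=> // f Ff; first by rewrite aut_mulE; apply: (arrow_mapC qa cb bc); exact: pF.
rewrite invgM aut_mulE; apply: (arrow_mapC (arrowV pa) cc); last exact: qVF.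
by move=> /esym.
Qed.

Lemma arrow_moved a b g f : arrow a b g -> F f -> ~ F (g f).
Proof. by move=> [_ [_ bF _ _] gF _] Ff; apply: bF; exact: gF. Qed.

Lemma arrow_neq1 a b g : arrow a b g -> g <> 1.
Proof.
move=> ga g1; have := arrow_moved ga (sep_base sepF).
by rewrite g1; apply; exact: sep_base sepF.
Qed.

Lemma gconn_off_component (Q : set X) : gconn Q -> Q !=set0 ->
  (forall v, Q v -> ~ F v) -> exists2 D, component F D & Q `<=` D.
Proof.
move=> cQ [v Qv] QF; have [D cD Dv] := component_ex (QF v Qv).
by exists D => //; exact: gconn_sub_component cD cQ QF Qv Dv.
Qed.

Lemma moved_in_component g : (forall f, F f -> ~ F (g f)) ->
  exists2 D, component F D & forall f, F f -> D (g f).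
Proof.
move=> gF; have [||v|D cD DF] := @gconn_off_component (translate g F).
- exact: gconn_translate (sep_gconn sepF).
- by exists (g x0); rewrite translateE; exact: sep_base sepF.
- by move=> /gF; rewrite aut_invKV.
- by exists D => // f Ff; apply: DF; rewrite translateE.
Qed.

(** [F] is connected, so if its image avoids [F] it lies in one component, and
the same holds for the preimage. *)
Lemma moved_arrow g : (forall f, F f -> ~ F (g f)) -> exists a b, arrow a b g.
Proof.
move=> gF; have [b cb bg] := moved_in_component gF.
have gVF f : F f -> ~ F (g^-1 f) by move=> Ff /gF; rewrite aut_invKV.
have [a ca ag] := moved_in_component gVF.
by exists a, b.
Qed.

Lemma moved_arrow_to b g : (forall f, F f -> ~ F (g f)) -> component F b ->
  b (g x0) -> exists a, arrow a b g.
Proof.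
move=> /moved_arrow[a [b' ga]] cb bg; have Fx := sep_base sepF.
exists a; suff -> : b = b' by [].
have [_ cb' gF _] := ga.
exact: component_eq cb cb' bg (gF _ Fx).
Qed.

(** A vertex far from [S], inside [A], can be taken as the image of [x0]. *)
Lemma vtransitive_move P (A S : set X) : vtransitive P -> infinite_set A ->
  finite_set S -> exists g, [/\ P g, A (g x0) & forall s, S s -> ~ S (g s)].
Proof.
move=> tP iA fS; have [n Sn] := finite_sub_gball Xconn x0 fS.
have [v Av vS] := infinite_far Xlf n iA fS.
have [g Pg gv] := tP x0 v.
exists g; split=> //; first by rewrite gv.
move=> s /Sn; rewrite -(gball_aut _ g) gv => sv Ss.
exact: (vS _ Ss (gball_sym sv)).
Qed.

Lemma vtransitive_arrow P b : vtransitive P -> component F b ->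
  exists a g, P g /\ arrow a b g.
Proof.
move=> tP cb; have [g [Pg bg gF]] :=
  vtransitive_move tP (sep_infinite sepF cb) (sep_finite sepF).
by have [a ga] := moved_arrow_to gF cb bg; exists a, g.
Qed.

(** Arrows compose as soon as the middle components differ, so any arrow that
avoids [u] at both ends links an arrow into [b] to an arrow out of [a]. *)
Lemma arrow_ex P a b : is_subgroup P -> vtransitive P ->
  (forall D, component F D -> exists p c d,
     [/\ P p, arrow c d p, c <> D & d <> D]) ->
  component F a -> component F b -> exists2 p, P p & arrow a b p.
Proof.
move=> sP tP offP ca cb.
have [u [p [Pp pa]]] := vtransitive_arrow tP cb.
have [v [q' [Pq' /arrowV q'a]]] := vtransitive_arrow tP ca.
have {Pq'} Pq := sgV sP Pq'; set q := q'^-1 in q'a Pq.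
case: (pselect (u = v)) => [uv|uv]; last first.
  exists (p * q); first exact: sgM.
  by apply: arrow_comp q'a pa _ => /esym.
have [cu _ _ _] := pa.
have [r [c [d [Pr ra cNu dNu]]]] := offP u cu.
exists (p * (r * q)); first by apply: sgM => //; exact: sgM.
by apply: (arrow_comp (arrow_comp q'a ra _) pa) => //; rewrite -uv => /esym.
Qed.

Hypothesis Xprim : primitive X.

Lemma aut_neq1 g : g <> 1 -> exists v, g v <> v.
Proof.
move=> g1; apply: contrapT => H; apply: g1; apply: autP => v.
by apply: contrapT => gv; apply: H; exists v.
Qed.

(** The orbits of a normal subgroup are the classes of an invariant equivalence
relation, and not all of them are singletons. *)
Lemma normal_vtransitive N : is_subgroup N -> normalised N setT ->
  (exists2 n, N n & n <> 1) -> vtransitive N.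
Proof.
move=> sN nN [n Nn /aut_neq1[v nv]].
pose R x y := exists2 g, N g & g x = y.
have [||R1|RT x y] := Xprim.2 R.
- split.
  + by move=> x; exists 1 => //; exact: sg1.
  + move=> x y z [g Ng <-] [h Nh <-]; exists (h * g) => //; exact: sgM.
  + move=> x y [g Ng <-]; exists g^-1; first exact: sgV.
    by rewrite aut_invK.
- have Rg h x y : R x y -> R (h x) (h y).
    move=> [k Nk <-]; exists (h * k * h^-1); first exact: nN.
    by rewrite !aut_mulE aut_invK.
  by move=> h x y; split=> [|/(Rg h^-1)]; [exact: Rg|rewrite !aut_invK].
- by case: nv; apply/esym/R1; exists n.
- exact: RT.
Qed.

(** The automorphisms of bounded displacement form a normal subgroup, so if
there were a nontrivial one then some of them would be arrows; but an arrow
moves the deep points of all but two components very far. *)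
Lemma unbounded_displacement g r : g <> 1 -> exists v, ~ gball r v (g v).
Proof.
move=> g1; apply: contrapT => H.
pose N : set (aut X) := [set h | exists n, forall v, gball n v (h v)].
have sN : is_subgroup N.
  split; first by exists 0%N.
  - move=> h k [m hm] [n kn]; exists (n + m)%N => v.
    exact: gball_trans (kn v) (hm (k v)).
  - by move=> h [n hn]; exists n => v; apply/gball_sym; rewrite -{2}(aut_invKV h v).
have nN : normalised N setT.
  move=> h k _ [n kn]; exists n => v.
  by rewrite -(gball_aut _ h^-1) !aut_mulE aut_invK.
have tN : vtransitive N.
  apply: normal_vtransitive => //; exists g => //; exists r => v.
  by apply: contrapT => gv; apply: H; exists v.
have [c [cc _ _ _]] := sep_four sepF set0 set0 set0.
have [a [h [[n hn] ha]]] := vtransitive_arrow tN cc.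
have [e [ce ea ec _]] := sep_four sepF a c c.
have [v ev vF] := infinite_far Xlf n (sep_infinite sepF ce) (sep_finite sepF).
have cv := arrow_mapC ha ce ea ev.
apply: ec; apply: (component_eq ce cc _ cv).
apply: (gconn_sub_component ce (@gball_gconn _ n v) _ (gball_center _ _) ev) => //.
by move=> u /gball_sym vu Fu; exact: vF Fu vu.
Qed.

(** If [g] moves [v] farther than the diameter of [S], then the conjugate of [g]
by an element carrying [x0] to [v] moves [S] off itself. *)
Lemma displacement_move P g (S : set X) : vtransitive P -> g <> 1 ->
  finite_set S -> exists2 h, P h & forall s, S s -> ~ S ((h^-1 * g * h) s).
Proof.
move=> tP g1 fS; have [n Sn] := finite_sub_gball Xconn x0 fS.
have [v vg] := unbounded_displacement (n + n) g1.
have [h Ph hv] := tP x0 v.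
exists h => // s /Sn; rewrite -(gball_aut _ (g * h)) !aut_mulE hv => gs.
move=> /Sn; rewrite -(gball_aut _ h) hv aut_invKV => vs.
by apply: vg; exact: gball_trans vs (gball_sym gs).
Qed.

End Arrows.


(** * Finiteness from local finiteness *)

Section Finiteness.
Variable X : graph.
Hypothesis Xlf : locally_finite X.
Hypothesis Xconn : graph_connected X.
Implicit Types (F Q D E S : set X) (g h : aut X).

Lemma finite_maps (s : seq X) Q x : finite_set Q ->
  finite_set [set map g s | g in [set g : aut X | Q (g x)]].
Proof.
move=> fQ; elim: s => [|v s IH].
  apply: (@sub_finite_set _ _ [set [::]]); last exact: finite_set1.
  by move=> _ [g _ <-].
have [n xv] := gball_ex Xconn x v.
have fB : finite_set (\bigcup_(q in Q) gball n q).
  by apply: bigcup_finite => // q _; exact: gball_finite.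
apply: sub_finite_set (finite_image (fun p => p.1 :: p.2) (finite_setX fB IH)).
move=> _ [g Qg <-]; exists (g v, map g s) => //; split; last by exists g.
by exists (g x) => //; rewrite gball_aut.
Qed.

(** An automorphism that carries [x] into a finite set carries each vertex of
[S] into a ball around that set, which leaves finitely many possibilities for
its restriction to [S].  This yields the finiteness of stabilisers, of families
of translates, and of the set of cosets. *)
Lemma finite_im_aut (T : Type) (phi : aut X -> T) S Q x :
  finite_set S -> finite_set Q ->
  (forall g h : aut X, (forall v, S v -> g v = h v) -> phi g = phi h) ->
  finite_set [set phi g | g in [set g : aut X | Q (g x)]].
Proof.
move=> fS fQ phiS.
have /finite_seqP[s sS] : finite_set (S : set {classic X}) by [].
pose psi l := phi (xget 1 [set g : aut X | Q (g x) /\ map g s = l]).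
apply: sub_finite_set (finite_image psi (finite_maps s x fQ)).
move=> _ [g Qg <-]; exists (map g s); first by exists g.
apply: phiS; case: xgetP => [h _ [_ hs] v Sv|/(_ g) []//].
apply: ((@eq_in_map {classic X} _ h g s).2 hs).
by move: Sv; rewrite sS.
Qed.

Lemma translate1 D : translate 1 D = D.
Proof. by rewrite /translate invg1. Qed.

Lemma translateM g h D : translate (g * h) D = translate g (translate h D).
Proof. by rewrite /translate invgM. Qed.

Lemma translateK g : cancel (translate g) (translate g^-1).
Proof. by move=> D; rewrite -translateM mulVg translate1. Qed.

(** A component is determined by the boundary and one vertex. *)
Lemma translate_eq F D w g h : component F D -> D w ->
  (forall v, F v -> g v = h v) -> g w = h w -> translate g D = translate h D.
Proof.
move=> cD Dw ghF ghw; have := component_translate h cD.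
suff <- : translate g F = translate h F.
  move=> cD'; apply: (component_eq (component_translate g cD) cD' (u := g w)).
    by rewrite translateE.
  by rewrite ghw translateE.
apply/seteqP; split=> u; rewrite /translate /mkset => Fu.
  by rewrite -(aut_invKV g u) ghF // aut_invK.
by rewrite -(aut_invKV h u) -ghF // aut_invK.
Qed.

Lemma finite_translates F D Q : finite_set F -> component F D -> finite_set Q ->
  finite_set [set translate g D | g in [set g : aut X | exists2 f, F f & Q (g f)]].
Proof.
move=> fF cD fQ; have [[w Dw] _ _ _] := cD.
apply: (@sub_finite_set _ _
  (\bigcup_(f in F) [set translate g D | g in [set g : aut X | Q (g f)]])).
  by move=> _ [g [f Ff Qg] <-]; exists f => //; exists g.
apply: bigcup_finite => // f Ff; apply: (@finite_im_aut _ _ (w |` F)) => //.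
  by rewrite finite_setU; split.
move=> g h gh; apply: (translate_eq cD Dw); last by apply: gh; left.
by move=> v Fv; apply: gh; right.
Qed.

(** ** The separation cocycle of a component *)

Section Cuts.
Variables (F D : set X).
Hypotheses (fF : finite_set F) (cF : gconn F) (cD : component F D).

Definition cut x y := [set E | [/\ exists g, E = translate g D, E x & ~ E y]].

(** A connected set with a vertex inside and a vertex outside a component meets
the separating set. *)
Lemma gconn_crosses F' D' Q x y : component F' D' -> gconn Q -> Q x -> Q y ->
  D' x -> ~ D' y -> exists2 v, F' v & Q v.
Proof.
move=> cD' cQ Qx Qy Dx NDy; apply: contrapT => H; apply: NDy.
apply: (gconn_sub_component cD' cQ _ Qx Dx) Qy.
by move=> v Qv Fv; apply: H; exists v.
Qed.

Lemma finite_cut x y : finite_set (cut x y).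
Proof.
have [n xy] := gball_ex Xconn x y.
apply: sub_finite_set (finite_translates fF cD (gball_finite Xlf n x)).
move=> _ [[g ->] gx gy]; exists g => //.
have [v Fv Bv] := gconn_crosses (component_translate g cD)
  (@gball_gconn _ n x) (gball_center _ _) xy gx gy.
by exists (g^-1 v) => //; rewrite aut_invKV.
Qed.

Definition card_set (A : set (set X)) : nat := #|` fset_set A|%fset.

Definition cutn x y := card_set (cut x y).

Lemma cutn_split (A B : set (set X)) : finite_set A ->
  card_set A = (card_set (A `&` B) + card_set (A `\` B))%N.
Proof.
move=> fA; have fAB := finite_setIl B fA; have fAD := finite_setD B fA.
rewrite /card_set -cardfsUI -fset_setU // setUIDK -fset_setI //.
have -> : (A `&` B) `&` (A `\` B) = set0.
  by apply/seteqP; split=> // u [[_ uB] [_ /(_ uB)]].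
by rewrite fset_set0 cardfs0 addn0.
Qed.

(** Sort the translates of [D] by which of [x], [y], [z] they contain: both
sides count each translate that separates the three points exactly once. *)
Lemma cutn_cocycle x y z :
  (cutn x y + cutn y z + cutn z x = cutn y x + cutn z y + cutn x z)%N.
Proof.
pose tr E := exists g, E = translate g D.
pose p x y z := card_set [set E : set X | [/\ tr E, E x, E y & ~ E z]].
pose q x y z := card_set [set E : set X | [/\ tr E, E x, ~ E y & ~ E z]].
have E a b c : cutn a b = (p a c b + q a b c)%N.
  rewrite /cutn (cutn_split [set E | E c] (finite_cut a b)); congr (_ + _)%N.
    by congr card_set; apply/seteqP; split=> A [] // [].
  by congr card_set; apply/seteqP; split=> A [] // [].
have pC a b c : p a b c = p b a c.
  by congr card_set; apply/seteqP; split=> A /= [].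
have qC a b c : q a b c = q a c b.
  by congr card_set; apply/seteqP; split=> A /= [].
rewrite (E x y z) (E y z x) (E z x y) (E y x z) (E z y x) (E x z y).
rewrite (pC y z x) (pC z x y) (pC x y z) (qC y x z) (qC z y x) (qC x z y).
lia.
Qed.

Lemma cutn_aut g x y : cutn (g x) (g y) = cutn x y.
Proof.
apply/fcard_eq; [exact: finite_cut..|].
suff -> : cut (g x) (g y) = [set translate g E | E in cut x y].
  by apply: inj_card_eq => E E' _ _; exact: (can_inj (translateK g)).
apply/seteqP; split=> [_ [[h ->] hx hy]|_ [_ [[h ->] hx hy] <-]].
  exists (translate (g^-1 * h) D); last by rewrite -translateM mulgA mulgV mul1g.
  by rewrite translateM; split; [exists (g^-1 * h); rewrite translateM|..];
    rewrite /translate /mkset ?invgK.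
by split; rewrite ?translateE //; exists (g * h); rewrite translateM.
Qed.

End Cuts.
End Finiteness.


(** * No component is preferred *)

Section Unimodularity.
Variable X : graph.
Hypothesis Xlf : locally_finite X.
Hypothesis Xconn : graph_connected X.
Variables (F : set X) (x0 : X).
Hypothesis sepF : separator F x0.
Hypothesis Xprim : primitive X.
Implicit Types (a b c d e C D E : set X) (g h p q t : aut X).

Let Fx0 : F x0 := sep_base sepF.
Let fF := sep_finite sepF.
Let cF := sep_gconn sepF.

Lemma vtransitiveT : vtransitive [set: aut X].
Proof. by move=> x y; have [g gxy] := Xprim.1 x y; exists g. Qed.

Lemma arrow_exp C D t i : arrow F D C t -> C <> D -> arrow F D C (t ^+ i.+1).
Proof.
move=> ta CD; elim: i => [|i IH]; first by rewrite expg1.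
by rewrite expgS; exact: (arrow_comp Xconn sepF IH ta CD).
Qed.

(** The preimages of [F] under the powers of an arrow with distinct ends are
pairwise disjoint, so each vertex lies in at most one of them. *)
Lemma arrow_exp_escape C D t (B : set X) : arrow F D C t -> C <> D ->
  finite_set B -> exists k, forall i v, (k <= i)%N -> B v -> ~ F ((t ^+ i) v).
Proof.
move=> ta CD fB.
have once v i j : (i < j)%N -> F ((t ^+ i) v) -> ~ F ((t ^+ j) v).
  move=> ij Fi; have -> : j = ((j - i).-1.+1 + i)%N by lia.
  by rewrite expgnDr aut_mulE; exact: (arrow_moved (arrow_exp _ ta CD)).
have /choice[r rP] v : exists k, forall i, (k <= i)%N -> ~ F ((t ^+ i) v).
  case: (pselect (exists i, F ((t ^+ i) v))) => [[i Fi]|NF].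
    by exists i.+1 => j ij; exact: once Fi.
  by exists 0%N => i _ Fi; apply: NF; exists i.
have [k kP] := finite_bound r fB.
by exists k => i v ki Bv; apply: rP; apply: leq_trans ki; exact: kP.
Qed.

(** Balance is an invariant equivalence relation by the cocycle identity.  Were
it equality, the cocycle would turn the automorphism group into a group of
translations of the integers; the group would be commutative, and its elements
would have bounded displacement by transitivity. *)
Lemma balanced_all D : component F D ->
  forall x y, cutn D x y = cutn D y x.
Proof.
move=> cD; pose R x y := cutn D x y = cutn D y x.
have coc := cutn_cocycle Xlf Xconn fF cD.
have caut := cutn_aut Xlf Xconn fF cD.
have [||R1|//] := Xprim.2 R.
- split=> // x y z; rewrite /R => xy yz.
  by have := coc x y z; lia.
- by move=> g x y; rewrite /R !caut.
have com (g h : aut X) x : g (h x) = h (g x).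
  apply/R1; rewrite /R.
  have := coc x (g x) (g (h x)); have := coc x (h x) (h (g x)).
  have := coc x (g (h x)) (h (g x)); rewrite !caut; lia.
have [a [t [_ ta]]] := vtransitive_arrow Xlf Xconn sepF vtransitiveT cD.
have [n xn] := gball_ex Xconn x0 (t x0).
have [v []] := unbounded_displacement Xlf Xconn sepF Xprim n
  (arrow_neq1 sepF ta).
have [h <-] := Xprim.1 x0 v.
by rewrite com gball_aut.
Qed.

Lemma first_step (P : nat -> Prop) m : ~ P 0%N -> P m ->
  exists i, [/\ (i < m)%N, ~ P i & P i.+1].
Proof.
elim: m => [//|m IH] P0 Pm; case: (pselect (P m)) => [/(IH P0)[i [im ? ?]]|NPm].
  by exists i; split=> //; lia.
by exists m.
Qed.

(** The [m] translates of [D] by the positive powers of [t] up to [m] form a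
chain, and each of them separates [x0] from its image under [t ^+ m]. *)
Lemma cutn_exp_ge C D t m : arrow F D C t -> C <> D ->
  (m <= cutn D x0 ((t ^+ m) x0))%N.
Proof.
move=> ta CD; have [cD cC _ _] := ta.
have [_ DF _ _] := cD; have [_ CF _ _] := cC.
have back i : translate (t ^+ i.+1) D x0.
  by have [_ _ _] := arrow_exp i ta CD; apply.
have forth i : ~ D ((t ^+ i) x0).
  case: i => [|i]; first by rewrite expg0 => /DF.
  move=> Di; have [_ _ tC _] := arrow_exp i ta CD.
  by apply: CD; exact: component_eq cC cD (tC _ Fx0) Di.
have tr i j x : translate (t ^+ i) D ((t ^+ (j + i)) x) <-> D ((t ^+ j) x).
  by rewrite addnC expgnDr aut_mulE translateE.
apply: leq_card_fset_set; first exact: (finite_cut Xlf Xconn fF cD).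
have inj : {in `I_m &, injective (fun i => translate (t ^+ i.+1) D)}.
  suff lt i j : (i < j)%N -> translate (t ^+ i.+1) D <> translate (t ^+ j.+1) D.
    move=> i j _ _ ij; apply: contrapT => /eqP; rewrite neq_ltn => /orP[/lt|/lt].
      exact.
    by apply; rewrite ij.
  move=> ij eij.
  suff : translate (t ^+ i.+1) D ((t ^+ (0 + i.+1)) x0).
    by rewrite tr; exact: forth.
  rewrite eij /= /translate /mkset.
  have -> : (t ^+ j.+1)^-1 ((t ^+ (0 + i.+1)) x0) = (t ^+ (j - i.+1).+1)^-1 x0.
    have -> : j.+1 = (i.+1 + (j - i.+1).+1)%N by lia.
    by rewrite expgnDr invgM aut_mulE add0n aut_invK.
  exact: back.
rewrite -(card_le_eql (inj_card_eq inj)).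
apply: subset_card_le => _ [i /= im <-]; split; first by exists (t ^+ i.+1).
  exact: back.
have -> : m = (m - i.+1 + i.+1)%N by lia.
by rewrite tr; exact: forth.
Qed.

(** An arrow [t] that starts elsewhere than [D] provides a translate of [D]
inside another component.  If [t] starts at [D], consider the translates of [D]
that separate [x0] from its image under [t ^+ m].  At least [m] of them contain
[x0].  One that contains the image of [x0] instead, and whose boundary is far
along the axis, would be disjoint from [D]; so if there are no disjoint
translates, the boundaries of all of these are near [x0], their number is
bounded independently of [m], and balance fails. *)
Lemma disjoint_translates D : component F D -> exists g h,
  (forall u, translate g D u -> ~ translate h D u) /\
  infinite_set [set u | ~ translate g D u /\ ~ translate h D u].
Proof.
move=> cD; have [C [cC CD _ _]] := sep_four sepF D D D.
have [_ CF _ _] := cC; have [_ DF _ _] := cD.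
have [D' [t [_ ta]]] := vtransitive_arrow Xlf Xconn sepF vtransitiveT cC.
(* A third component, to leave room outside the two translates. *)
have [E [cE EC ED _]] := sep_four sepF C D D.
have iE := sep_infinite sepF cE.
case: (pselect (D = D')) => [DD'|DD']; last first.
  have tD u : translate t D u -> C u.
    by move=> /(arrow_mapC Xconn sepF ta cD DD'); rewrite aut_invKV.
  exists 1, t; rewrite translate1; split.
    by move=> u Du /tD Cu; apply: CD; exact: component_eq cC cD Cu Du.
  apply: sub_infinite_set iE => u Eu; split.
    by move=> Du; apply: ED; exact: component_eq cE cD Eu Du.
  by move=> /tD Cu; apply: EC; exact: component_eq cE cC Eu Cu.
move: ta; rewrite -DD' => {D' DD'} ta.
apply: contrapT => H.
have [n Bx] := gball_ex Xconn x0 (t x0).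
have [r Fr] := finite_sub_gball Xconn x0 fF.
(* [B] joins [x0] to [t x0]; a translate of [F] that meets [B] lies in [B']. *)
pose B := gball n x0; pose B' := gball (n + (r + r)) x0.
have [k kB] := arrow_exp_escape ta CD (gball_finite Xlf (n + (r + r)) x0).
have escC i v : (k < i)%N -> B' v -> C ((t ^+ i) v).
  move=> ki Bv.
  have cB := gconn_translate (g := t ^+ i) (@gball_gconn _ (n + (r + r)) x0).
  have Cx : C ((t ^+ i) x0).
    rewrite -(ltn_predK ki); have [_ _ tC _] := arrow_exp i.-1 ta CD; exact: tC.
  apply: (gconn_sub_component cC cB _ _ Cx); rewrite ?translateE //.
    move=> u Bu Fu; apply: (kB i _ (ltnW ki) Bu); rewrite aut_invKV //.
  exact: gball_center.
pose Q := \bigcup_(i in `I_k.+1) translate (t ^+ i) B.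
have fQ : finite_set Q.
  apply: bigcup_finite => // i _.
  apply: sub_finite_set (finite_image (t ^+ i) (gball_finite Xlf n x0)).
  by move=> u Bu; exists ((t ^+ i)^-1 u) => //; rewrite aut_invKV.
pose W := [set translate g D | g in [set g : aut X | exists2 f, F f & Q (g f)]].
have fW : finite_set W := finite_translates Xlf Xconn fF cD fQ.
have cutW m : cut D ((t ^+ m) x0) x0 `<=` W.
  move=> _ [[g ->] gm g0].
  have [i [im gi gi1]] := @first_step (fun i => translate g D ((t ^+ i) x0)) m g0 gm.
  have [v Fv Bv] := gconn_crosses (component_translate g cD)
    (gconn_translate (g := t ^+ i) (@gball_gconn _ n x0))
    (x := (t ^+ i.+1) x0) (y := (t ^+ i) x0)
    ltac:(by rewrite expgSr aut_mulE translateE)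
    ltac:(by rewrite translateE; exact: gball_center) gi1 gi.
  have [ik|ki] := leqP i k.
    by exists g => //; exists (g^-1 v); rewrite ?aut_invKV //; exists i.
  (* The boundary lies in [C], hence misses the connected set [D `|` F], which
     contains [x0] and is therefore outside the translate. *)
  have gFC u : translate g F u -> C u.
    move=> Fu; rewrite -(aut_invKV (t ^+ i) u); apply: escC ki _.
    apply: gball_trans Bv _; rewrite gball_aut -(gball_aut _ g^-1).
    by apply: gball_trans (Fr _ Fu); apply/gball_sym; exact: Fr.
  have gDD u : D u -> ~ translate g D u.
    move=> Du gDu; have [||v' gv' DFv'] := gconn_crosses (component_translate g cD)
      (component_gconnU Xconn cD cF (ex_intro _ x0 Fx0)) _ _ gDu g0.
    - by left.
    - by right.
    have Cv' := gFC _ gv'; case: DFv' => [Dv'|/(CF _ Cv')//].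
    by apply: CD; exact: component_eq cC cD Cv' Dv'.
  have tV u : translate t^-1 D u -> D u.
    rewrite /translate /mkset invgK => Dtu; rewrite -(aut_invK t u).
    by apply: (arrow_mapC Xconn sepF (arrowV ta) cD) Dtu => /esym.
  (* [D] itself is shrunk by [t^-1] so that the complement is infinite. *)
  case: H; exists t^-1, g; split; first by move=> u /tV; exact: gDD.
  have : infinite_set (translate t^-1 E).
    move=> fE; apply: iE; apply: sub_finite_set (finite_image t fE) => u Eu.
    by exists (t^-1 u); rewrite ?aut_invKV // translateE.
  apply: sub_infinite_set => u; rewrite /translate /mkset invgK => Etu; split.
    by move=> Dtu; apply: ED; exact: component_eq cE cD Etu Dtu.
  apply: gDD; rewrite -(aut_invK t u).
  exact: (arrow_mapC Xconn sepF (arrowV ta) cE EC).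
have := cutn_exp_ge (card_set W).+1 ta CD; rewrite balanced_all //.
apply/negP; rewrite -leqNgt; apply: fsubset_leq_card.
by rewrite -fset_set_sub //; exact: (finite_cut Xlf Xconn fF cD).
Qed.

(** Otherwise every arrow in a conjugate-invariant [H] starts or ends at [D],
and likewise for the translates of [D] with respect to their boundaries.  Let
[h] carry a large ball, containing the boundaries of two disjoint translates of
[D], far away from both translates.  Then the inverse of [h] must carry the ball
into each of the two, which is absurd. *)
Lemma arrow_off (H : set (aut X)) : is_subgroup H -> normalised H setT ->
  vtransitive H -> forall D, component F D -> exists p c d,
  [/\ H p, arrow F c d p, c <> D & d <> D].
Proof.
move=> sH nH tH D cD; apply: contrapT => noH.
have [g1 [g2 [disj inf]]] := disjoint_translates cD.
have fgF g : finite_set (translate g F).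
  apply: sub_finite_set (finite_image g fF) => u Fu.
  by exists (g^-1 u); rewrite ?aut_invKV.
have [n SB] := finite_sub_gball Xconn x0
  (S := translate g1 F `|` translate g2 F)
  ltac:(by rewrite finite_setU; split; exact: fgF).
set B := gball n x0 in SB.
have cB : gconn B := @gball_gconn _ n x0.
have [h [Hh [hg1 hg2] hB]] := vtransitive_move Xlf Xconn x0 tH inf
  (gball_finite Xlf n x0).
have Bx0 : B x0 := gball_center _ _.
have hVB u : B u -> ~ B (h^-1 u) by move=> Bu /hB; rewrite aut_invKV.
have inside g : translate g F `<=` B -> ~ translate g D (h x0) ->
    forall u, B u -> translate g D (h^-1 u).
  move=> gB hg; pose p := g^-1 * h * g.
  have Hp : H p by have := nH g^-1 h Logic.I Hh; rewrite invgK.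
  have gF f : F f -> B (g f) by move=> Ff; apply: gB; rewrite translateE.
  have pF f : F f -> ~ F (p f).
    move=> Ff; rewrite !aut_mulE => Fp; have /hB := gF f Ff; apply; exact: gB.
  have [c [d pa]] := moved_arrow sepF pF.
  have dD : d <> D.
    move=> dD; apply: hg; have [_ _ pd _] := pa.
    have := pd _ Fx0; rewrite dD !aut_mulE => Dh.
    have ch := gconn_translate (g := h) cB.
    apply: (gconn_sub_component (component_translate g cD) ch _ _ Dh);
      rewrite ?translateE ?aut_invKV //; last exact: gF.
    by move=> v hv /gB Bv; apply: (hVB v).
  have cDe : c = D.
    by apply: contrapT => cD'; apply: noH; exists p, c, d.
  move=> u Bu; have ch := gconn_translate (g := h^-1) cB.
  have [_ _ _ pVc] := pa.
  have := pVc _ Fx0; rewrite cDe /p !invgM invgK !aut_mulE => Dh.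
  apply: (gconn_sub_component (component_translate g cD) ch _ _ Dh);
    rewrite ?translateE //; last exact: gF.
  by move=> v hv /gB Bv; have := hB v Bv; move: hv; rewrite /translate /mkset invgK.
have SB1 : translate g1 F `<=` B by move=> u ?; apply: SB; left.
have SB2 : translate g2 F `<=` B by move=> u ?; apply: SB; right.
exact: disj _ (inside g1 SB1 hg1 _ Bx0) (inside g2 SB2 hg2 _ Bx0).
Qed.

Lemma normal_arrow_ex (H : set (aut X)) a b : is_subgroup H ->
  normalised H setT -> vtransitive H -> component F a -> component F b ->
  exists2 p, H p & arrow F a b p.
Proof.
move=> sH nH tH; apply: (arrow_ex Xlf Xconn sepF sH tH).
exact: arrow_off.
Qed.

End Unimodularity.


(** * The automorphism group is not discrete *)

Section PingPong.
Variable X : graph.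
Hypothesis Xlf : locally_finite X.
Hypothesis Xconn : graph_connected X.
Variables (F : set X) (x0 : X).
Hypothesis sepF : separator F x0.
Implicit Types (g h k m t w : aut X).

Variables (a b b' : set X) (K : set (aut X)) (t : aut X).
Hypotheses (sK : is_subgroup K) (Ka : forall k, K k -> k <> 1 -> arrow F a a k).
Hypotheses (ca : component F a) (ta : arrow F b b' t).
Hypotheses (ab : a <> b) (ab' : a <> b') (bb' : b <> b').

(** Reduced words in the nontrivial elements of [K], all of which are arrows
from [a] to [a], and in [t] and its inverse, where [t] is an arrow from [b] to
[b'].  The index is the component into which the first letter points ([set0] for
the empty word); a letter may be put in front of a word exactly when the arrow
composes with it. *)
Inductive reduced : set X -> aut X -> Prop :=
| reduced1 : reduced set0 1
| reducedK k m c : K k -> k <> 1 -> c <> a -> reduced c m -> reduced a (k * m)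
| reducedt m c : c <> b -> reduced c m -> reduced b' (t * m)
| reducedtV m c : c <> b' -> reduced c m -> reduced b (t^-1 * m).

Lemma component_neq0 (c : set X) : component F c -> c <> set0.
Proof. by move=> [[u cu] _ _ _] c0; move: cu; rewrite c0. Qed.

Lemma reduced_map c m : reduced c m ->
  m = 1 \/ component F c /\ forall f, F f -> c (m f).
Proof.
have [cb cb' _ _] := ta.
have step d e q c' m' : arrow F d e q -> c' <> d ->
    m' = 1 \/ component F c' /\ (forall f, F f -> c' (m' f)) ->
    component F e /\ forall f, F f -> e ((q * m') f).
  move=> qa c'd H; have [_ ce qF _] := qa; split=> // f Ff.
  case: H => [->|[cc' mc']]; first by rewrite mulg1; exact: qF.
  by rewrite aut_mulE; apply: (arrow_mapC Xconn sepF qa cc' c'd); exact: mc'.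
elim=> [|k m' c' Kk k1 c'a _ IH|m' c' c'b _ IH|m' c' c'b _ IH]; first by left.
- by right; exact: step (Ka Kk k1) c'a IH.
- by right; exact: step ta c'b IH.
- by right; exact: step (arrowV ta) c'b IH.
Qed.

Lemma reduced_inv c m : reduced c m ->
  [\/ c = set0,
      c = a /\ exists k m' c', [/\ K k, c' <> a, reduced c' m' & m = k * m'],
      c = b' /\ exists m' c', [/\ c' <> b, reduced c' m' & m = t * m'] |
      c = b /\ exists m' c', [/\ c' <> b', reduced c' m' & m = t^-1 * m']].
Proof.
case=> [|k m' c' Kk k1 c'a rm|m' c' c'b rm|m' c' c'b rm]; first by constructor 1.
- by constructor 2; split=> //; exists k, m', c'.
- by constructor 3; split=> //; exists m', c'.
- by constructor 4; split=> //; exists m', c'.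
Qed.

Let word m := exists c, reduced c m.

Let a0 := component_neq0 ca.
Let b0 : b <> set0. Proof. by have [cb _ _ _] := ta; exact: component_neq0. Qed.
Let b'0 : b' <> set0. Proof. by have [_ cb' _ _] := ta; exact: component_neq0. Qed.

Lemma wordK k m : K k -> word m -> word (k * m).
Proof.
move=> Kk [c rm].
case: (pselect (c = a)) => ca'; last first.
  case: (pselect (k = 1)) => [->|k1]; first by exists c; rewrite mul1g.
  by exists a; exact: reducedK rm.
have [|[_ [k' [m' [c' [Kk' c'a rm' ->]]]]]|[]|[]] := reduced_inv rm.
- by rewrite ca' => /a0.
- rewrite mulgA; case: (pselect (k * k' = 1)) => [->|kk1].
    by exists c'; rewrite mul1g.
  by exists a; apply: reducedK rm' => //; exact: sgM.
- by rewrite ca' => /ab'.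
- by rewrite ca' => /ab.
Qed.

Lemma wordt m : word m -> word (t * m).
Proof.
move=> [c rm]; case: (pselect (c = b)) => cb; last by exists b'; exact: reducedt rm.
have [|[]|[]|[_ [m' [c' [_ rm' ->]]]]] := reduced_inv rm.
- by rewrite cb => /b0.
- by rewrite cb => /esym/ab.
- by rewrite cb => /bb'.
- by exists c'; rewrite mulgA mulgV mul1g.
Qed.

Lemma wordtV m : word m -> word (t^-1 * m).
Proof.
move=> [c rm]; case: (pselect (c = b')) => cb; last by exists b; exact: reducedtV rm.
have [|[]|[_ [m' [c' [_ rm' ->]]]]|[]] := reduced_inv rm.
- by rewrite cb => /b'0.
- by rewrite cb => /esym/ab'.
- by exists c'; rewrite mulgA mulVg mul1g.
- by rewrite cb => /esym/bb'.
Qed.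

(** The reduced words are stable under multiplication on the left by [K], [t]
and the inverse of [t], hence so they are by the group that these generate.  Its
elements are thus reduced words, and the nontrivial ones move [F] into a
component. *)
Lemma ping_pong : exists M : set (aut X), [/\ is_subgroup M, K `<=` M, M t &
  forall m f, M m -> m <> 1 -> F f -> ~ F (m f)].
Proof.
(* The group of all elements that preserve the set of reduced words. *)
exists [set m | forall w, word w -> word (m * w) /\ word (m^-1 * w)]; split.
- split=> [w|g h Mg Mh w ww|g Mg w].
  + by rewrite invg1 mul1g.
  + rewrite -mulgA invgM -mulgA.
    by split; [apply (Mg _ (Mh _ ww).1).1 | apply (Mh _ (Mg _ ww).2).2].
  + by move=> /Mg; rewrite invgK => -[].
- by move=> k Kk w ww; split; apply: wordK => //; exact: sgV.
- by move=> w ww; split; [exact: wordt|exact: wordtV].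
- move=> m f Mm m1 Ff; have w1 : word 1 by exists set0; exact: reduced1.
  have [[c rm] _] := Mm _ w1; move: rm; rewrite mulg1 => /reduced_map[//|].
  by move=> [[_ cF _ _] mc]; apply: cF; exact: mc.
Qed.

End PingPong.

Section NotDiscrete.
Variable X : graph.
Hypothesis Xlf : locally_finite X.
Hypothesis Xconn : graph_connected X.
Variables (F : set X) (x0 : X).
Hypothesis sepF : separator F x0.
Hypothesis Xprim : primitive X.
Implicit Types (a b c d e D : set X) (g h k l t z : aut X).

Let Fx0 : F x0 := sep_base sepF.

(** Any arrow whose ends both differ from [b] becomes a loop at [a] after
conjugation by an arrow from [a] to [b]. *)
Lemma arrow_conj a b c d g (w : aut X) : arrow F a b w -> arrow F c d g -> b <> c ->
  b <> d -> arrow F a a (w^-1 * g * w).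
Proof.
move=> wa ga bc bd; rewrite -mulgA.
apply: (arrow_comp Xconn sepF (arrow_comp Xconn sepF wa ga bc) (arrowV wa)).
by move=> /esym.
Qed.

(** The orbit of [x] under a group containing its stabiliser is a block. *)
Lemma stabiliser_maximal (M : set (aut X)) x : is_subgroup M ->
  (forall g, g x = x -> M g) -> (exists2 m, M m & m x <> x) ->
  forall y, exists2 m, M m & m x = y.
Proof.
move=> sM stM [m Mm mx] y.
pose R u v := exists g n, [/\ M n, g x = u & (g * n) x = v].
have back g h n : M n -> (g * n) x = h x -> M (g^-1 * h).
  move=> Mn gn; have -> : g^-1 * h = n * (n^-1 * g^-1 * h).
    by rewrite !mulgA mulgV mul1g.
  apply: sgM => //; apply: stM; rewrite aut_mulE -gn !aut_mulE !aut_invK //.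
have [||R1|RT] := Xprim.2 R.
- split.
  + move=> u; have [g gu] := Xprim.1 x u; exists g, 1; rewrite mulg1.
    by split=> //; exact: sg1.
  + move=> u v y0 [g [n [Mn gu gn]]] [h [n' [Mn' hv hn]]].
    exists g, (g^-1 * h * n'); split=> //; last by rewrite !mulgA mulgV mul1g.
    by apply: sgM => //; apply: back Mn _; rewrite gn hv.
  + move=> u v [g [n [Mn gu gn]]]; exists (g * n), n^-1; split=> //.
      exact: sgV.
    by rewrite -mulgA mulgV mulg1.
- have Rg h u v : R u v -> R (h u) (h v).
    by move=> [g [n [Mn <- <-]]]; exists (h * g), n.
  by move=> h u v; split=> [|/(Rg h^-1)]; [exact: Rg|rewrite !aut_invK].
- by case: mx; apply/esym/R1; exists 1, m; rewrite mul1g.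
- have [g [n [Mn gx <-]]] := RT x y.
  by exists (g * n) => //; apply: sgM => //; exact: stM.
Qed.

Section Discrete.
Variable S : set X.
Hypotheses (fS : finite_set S) (S1 : forall g, pstab S g -> g = 1).

Lemma discrete_finite (Q : set X) x : finite_set Q ->
  finite_set [set g : aut X | Q (g x)].
Proof.
move=> fQ; rewrite -[X in finite_set X]image_id.
apply: (finite_im_aut Xlf Xconn x fS fQ) => g h gh.
have /S1 : pstab S (h^-1 * g) by move=> v Sv; rewrite aut_mulE gh // aut_invK.
by move=> /(congr1 (fun k => h * k)); rewrite mulgA mulgV mul1g mulg1.
Qed.

(** In the discrete case only finitely many automorphisms [l] fail to move [F]
off itself, and each of them, unless trivial, has a conjugate [u^-1 * l * u] that
does not fail.  Choose a ball containing all the translates of [F] by these [u],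
and let [w] carry it into [b].  If the conjugate of [k] by [w] fails, it is one
of the [l], and the conjugate by [w * u] does not fail. *)
Lemma discrete_move k b : k <> 1 -> component F b -> exists w a,
  arrow F a b w /\ forall f, F f -> ~ F ((w^-1 * k * w) f).
Proof.
move=> k1 cb; have fF := sep_finite sepF; have tT := vtransitiveT Xprim.
pose L : set (aut X) := [set l | exists2 f, F f & F (l f)].
have fL : finite_set L.
  apply: (@sub_finite_set _ _ (\bigcup_(f in F) [set g : aut X | F (g f)])).
    by move=> l [f Ff Fl]; exists f.
  by apply: bigcup_finite => // f _; exact: discrete_finite.
have /choice[u uP] l : exists u : aut X,
    l <> 1 -> forall s, F s -> ~ F ((u^-1 * l * u) s).
  case: (pselect (l = 1)) => [l1|l1]; first by exists 1.
  have [h _ hF] := displacement_move Xlf Xconn sepF Xprim tT l1 fF.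
  by exists h.
have [n Bn] : exists n, F `|` \bigcup_(l in L) [set u l f | f in F] `<=` gball n x0.
  apply: finite_sub_gball => //; rewrite finite_setU; split=> //.
  by apply: bigcup_finite => // l _; exact: finite_image.
have [w [_ bw wB]] := vtransitive_move Xlf Xconn x0 tT
  (sep_infinite sepF cb) (gball_finite Xlf n x0).
have FB f : F f -> gball n x0 f by move=> Ff; apply: Bn; left.
have wb v : gball n x0 v -> b (w v).
  move=> Bv; have cB := gconn_translate (g := w) (@gball_gconn _ n x0).
  apply: (gconn_sub_component cb cB _ _ bw); rewrite ?translateE //.
    by move=> y By /FB Fy; apply: wB By _; rewrite aut_invKV.
  exact: gball_center.
have [_ bF _ _] := cb.
have arr h : (forall f, F f -> gball n x0 (h f)) -> exists a, arrow F a b (w * h).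
  move=> hB; apply: (moved_arrow_to sepF) => //.
    by move=> f Ff; apply: bF; rewrite aut_mulE; apply: wb; exact: hB.
  by rewrite aut_mulE; apply: wb; exact: hB.
case: (pselect (L (w^-1 * k * w))) => [Ll|NL]; last first.
  have [a wa] := arr 1 FB; exists w, a; split; first by rewrite -(mulg1 w).
  by move=> f Ff Fl; apply: NL; exists f.
set l := w^-1 * k * w in Ll.
have l1 : l <> 1.
  move=> l1; apply: k1; have : w * l * w^-1 = 1 by rewrite l1 mulg1 mulgV.
  by rewrite /l !mulgA mulgV mul1g -mulgA mulgV mulg1.
have [|a wa] := arr (u l).
  by move=> f Ff; apply: Bn; right; exists l => //; exists f.
exists (w * u l), a; split=> //.
by have := uP l l1; rewrite /l invgM !mulgA.
Qed.

(** Conjugating by an arrow into a component that is not an end of any of the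
arrows at hand turns all of them into loops at one component.  A new element is
first turned into an arrow by [discrete_move], whose conjugator ends at another
component than that of the old loops and so keeps them loops. *)
Lemma discrete_conj_arrows (s : seq (aut X)) : (forall k, k \in s -> k <> 1) ->
  exists z a, component F a /\ forall k, k \in s -> arrow F a a (z^-1 * k * z).
Proof.
elim: s => [_|k0 s IH s1].
  by have [a [ca _ _ _]] := sep_four sepF set0 set0 set0; exists 1, a.
have [|z [a [ca za]]] := IH; first by move=> k ks; apply: s1; rewrite inE ks orbT.
have k01 : z^-1 * k0 * z <> 1.
  move=> e; apply: (s1 k0); first by rewrite inE eqxx.
  have : z * (z^-1 * k0 * z) * z^-1 = 1 by rewrite e mulg1 mulgV.
  by rewrite !mulgA mulgV mul1g -mulgA mulgV mulg1.
have [b [cb ba _ _]] := sep_four sepF a a a.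
have [w [c [wa wF]]] := discrete_move k01 cb.
have [d [e ga]] := moved_arrow sepF wF.
have [b' [cb' b'c b'd b'e]] := sep_four sepF c d e.
have [a' [w' [_ wa']]] := vtransitive_arrow Xlf Xconn sepF (vtransitiveT Xprim) cb'.
exists (z * w * w'), a'; split; first by have [] := wa'.
have conjE k : (z * w * w')^-1 * k * (z * w * w') =
    w'^-1 * (w^-1 * (z^-1 * k * z) * w) * w' by rewrite !invgM !mulgA.
move=> k; rewrite inE conjE => /orP[/eqP->|ks]; first exact: arrow_conj wa' ga _ _.
by apply: (arrow_conj wa' (arrow_conj wa (za k ks) _ _)).
Qed.

(** A finite point stabiliser is conjugate to one whose nontrivial elements are
loops at one component.  With an arrow between two other components it generates
a group that is larger, hence transitive by maximality, but in which no
nontrivial element maps a vertex of [F] into [F]. *)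
Lemma discrete_absurd : False.
Proof.
have /finite_seqP[s sP] : finite_set
    ([set g : aut X | [set x0] (g x0)] `\ 1).
  by apply: finite_setD; apply: discrete_finite; exact: finite_set1.
have [|z [a [ca za]]] := @discrete_conj_arrows s.
  by move=> k ks; have : [set` s] k by []; rewrite -sP => -[].
pose x := z^-1 x0; pose K : set (aut X) := [set g | g x = x].
have sK : is_subgroup K.
  split=> // [g h Kg Kh|g Kg]; rewrite /K /mkset ?aut_mulE ?Kh //.
  by rewrite -{1}Kg aut_invK.
have Ka k : K k -> k <> 1 -> arrow F a a k.
  move=> Kk k1; have -> : k = z^-1 * (z * k * z^-1) * z.
    by rewrite !mulgA mulVg mul1g -mulgA mulVg mulg1.
  apply: za; suff : [set` s] (z * k * z^-1) by [].
  rewrite -sP; split.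
    rewrite /mkset !aut_mulE; have -> : k (z^-1 x0) = z^-1 x0 := Kk.
    by rewrite aut_invKV.
  move=> e; apply: k1; have : z^-1 * (z * k * z^-1) * z = 1.
    by rewrite e mulg1 mulVg.
  by rewrite !mulgA mulVg mul1g -mulgA mulVg mulg1.
have [b [cb ba _ _]] := sep_four sepF a a a.
have [b' [cb' b'a b'b _]] := sep_four sepF a b b.
have sT : is_subgroup [set: aut X] by [].
have nT : normalised [set: aut X] setT by [].
have [t _ ta] :=
  normal_arrow_ex Xlf Xconn sepF Xprim sT nT (vtransitiveT Xprim) cb cb'.
have ab : a <> b by move=> /esym.
have ab' : a <> b' by move=> /esym.
have bb' : b <> b' by move=> /esym.
have [M [sM KM Mt MF]] := ping_pong Xconn sepF sK Ka ca ta ab ab' bb'.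
have tx : t x <> x.
  move=> tx; have [_ _ tF _] := Ka t tx (arrow_neq1 sepF ta).
  have [_ _ tF' _] := ta; apply: ab'.
  exact: component_eq ca cb' (tF _ Fx0) (tF' _ Fx0).
have trM := @stabiliser_maximal M x sM KM (ex_intro2 _ _ t Mt tx).
have [x1 Fx1 x10] := sep_two sepF.
have [m0 Mm0 m0x] := trM x0; have [m1 Mm1 m1x] := trM x1.
have m01 : (m1 * m0^-1) x0 = x1 by rewrite aut_mulE -m0x aut_invK.
apply: (MF (m1 * m0^-1) x0) => //; rewrite ?m01 //.
  by apply: sgM => //; exact: sgV.
by move=> e; apply: x10; rewrite -m01 e.
Qed.

End Discrete.

Lemma pstab_nontrivial (S : set X) : finite_set S ->
  exists2 g, pstab S g & g <> 1.
Proof.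
move=> fS; apply: contrapT => H; apply: (discrete_absurd fS) => g Sg.
by apply: contrapT => g1; apply: H; exists g.
Qed.

End NotDiscrete.


(** * Gluing and the subgroup generated by half-space fixators *)

Section Glue.
Variable X : graph.
Implicit Types (f : nat -> aut X) (Y : nat -> set X).

Lemma glue_fun f Y : (forall i j u, Y i u -> Y j u -> i = j) ->
  exists h : X -> X, (forall i u, Y i u -> h u = f i u) /\
    forall u, (forall i, ~ Y i u) -> h u = u.
Proof.
move=> Yinj.
have /choice[h hP] u : exists v,
    (forall i, Y i u -> v = f i u) /\ ((forall i, ~ Y i u) -> v = u).
  case: (pselect (exists i, Y i u)) => [[i Yu]|NY].
    exists (f i u); split=> [j Yj|/(_ i)//]; by rewrite (Yinj _ _ _ Yu Yj).
  by exists u; split=> // i Yu; case: NY; exists i.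
by exists h; split=> [i u|u]; [exact: (hP u).1|exact: (hP u).2].
Qed.

(** Automorphisms [f i] that preserve pairwise disjoint and non-adjacent sets
[Y i], and fix the outer boundary of these, act independently of each other:
adjacency only ever involves one of the [f i]. *)
Lemma glue f Y : (forall i j u, Y i u -> Y j u -> i = j) ->
  (forall i j u v, Y i u -> Y j v -> adj u v -> i = j) ->
  (forall i u, Y i (f i u) <-> Y i u) ->
  (forall i u v, Y i u -> adj u v -> ~ Y i v -> f i v = v) ->
  exists h : aut X, (forall i u, Y i u -> h u = f i u) /\
    forall u, (forall i, ~ Y i u) -> h u = u.
Proof.
move=> Yinj Yadj fY fbd.
have [h [hY hN]] := glue_fun f Yinj.
have [h' [h'Y h'N]] := glue_fun (fun i => (f i)^-1) Yinj.
have fVY i u : Y i ((f i)^-1 u) <-> Y i u by rewrite -(fY i) aut_invKV.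
have K : cancel h h'.
  move=> u; case: (pselect (exists i, Y i u)) => [[i Yu]|NY].
    by rewrite (hY i) // (h'Y i) ?fY // aut_invK.
  have {}NY i : ~ Y i u by move=> Yu; apply: NY; exists i.
  by rewrite hN // h'N.
have KV : cancel h' h.
  move=> u; case: (pselect (exists i, Y i u)) => [[i Yu]|NY].
    by rewrite (h'Y i) // (hY i) ?fVY // aut_invKV.
  have {}NY i : ~ Y i u by move=> Yu; apply: NY; exists i.
  by rewrite h'N // hN.
have loc (e : nat -> aut X) k : (forall i u, Y i u -> k u = e i u) ->
    (forall u, (forall i, ~ Y i u) -> k u = u) ->
    (forall i u v, Y i u -> adj u v -> ~ Y i v -> e i v = v) ->
    forall u v, adj u v -> adj (k u) (k v).
  move=> kY kN ebd.
  have half u v i : Y i u -> adj u v -> adj (k u) (k v).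
    move=> Yu uv; rewrite (kY i) //; case: (pselect (Y i v)) => [Yv|NYv].
      by rewrite (kY i) // aut_adj.
    rewrite kN; first by rewrite -{1}(ebd i u v) // aut_adj.
    by move=> j Yv; apply: NYv; rewrite (Yadj _ _ _ _ Yu Yv uv).
  move=> u v uv; case: (pselect (exists i, Y i u)) => [[i Yu]|NY].
    exact: half Yu uv.
  have {}NY i : ~ Y i u by move=> Yu; apply: NY; exists i.
  case: (pselect (exists i, Y i v)) => [[i Yv]|NYv].
    by apply: adj_sym; apply: half Yv _; exact: adj_sym.
  have {}NYv i : ~ Y i v by move=> Yu; apply: NYv; exists i.
  by rewrite !kN.
have hadj u v : adj (h u) (h v) <-> adj u v.
  split; last exact: (loc f).
  rewrite -{2}(K u) -{2}(K v); apply: (loc (fun i => (f i)^-1)) => // i x y Yx xy Ny.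
  by rewrite -{1}(fbd i x y) // aut_invK.
by exists (Aut (Bijective K KV) hadj).
Qed.

End Glue.

Section Simplicity.
Variable X : graph.
Hypothesis Xlf : locally_finite X.
Hypothesis Xconn : graph_connected X.
Variables (F : set X) (x0 : X).
Hypothesis sepF : separator F x0.
Hypothesis Xprim : primitive X.
Implicit Types (a b c d e y D E A : set X) (f g h k n p q : aut X).
Implicit Types (N M : set (aut X)).

(** The rigid stabiliser of [A]: the automorphisms supported on [A]. *)
Definition rist A : set (aut X) := [set g | forall v, ~ A v -> g v = v].

(** The union of the components other than [D]. *)
Definition off D : set X := [set v | ~ D v /\ ~ F v].

Lemma rist_stable A f u : rist A f -> A (f u) <-> A u.
Proof.
move=> fA; split=> Au; apply: contrapT => NAu; first by move: Au; rewrite fA.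
have := fA _ NAu => /(congr1 (aut_fun f^-1)); rewrite !aut_invK => fu.
by apply: NAu; rewrite fu.
Qed.

Lemma rist_conj A f g : rist A f -> rist (translate g A) (g * f * g^-1).
Proof.
by move=> fA v NAv; rewrite !aut_mulE fA ?aut_invKV.
Qed.

Definition rist_gens : set (aut X) :=
  [set k | exists g f D, [/\ component F D, rist (off D) f & k = g * f * g^-1]].

(** The subgroup generated by the conjugates of the rigid stabilisers. *)
Definition monolith : set (aut X) :=
  [set h | forall P, is_subgroup P -> rist_gens `<=` P -> P h].

Lemma monolith_subgroup : is_subgroup monolith.
Proof.
split=> [P sP _|g h Hg Hh P sP gP|g Hg P sP gP]; first exact: sg1.
  by apply: sgM => //; [exact: Hg|exact: Hh].
by apply: sgV => //; exact: Hg.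
Qed.

Lemma monolith_gen : rist_gens `<=` monolith.
Proof. by move=> g gg P sP; exact. Qed.

Lemma monolith_rist D f : component F D -> rist (off D) f -> monolith f.
Proof.
by move=> cD fD; apply: monolith_gen; exists 1, f, D; split=> //; rewrite invg1 mul1g mulg1.
Qed.

Lemma conj_subgroup M g : is_subgroup M ->
  is_subgroup [set m | M (g * m * g^-1)].
Proof.
move=> sM; split=> [|h k Mh Mk|h Mh].
- by rewrite /mkset mulg1 mulgV; exact: sg1.
- rewrite /mkset; have -> : g * (h * k) * g^-1 = (g * h * g^-1) * (g * k * g^-1).
    by rewrite !mulgA mulgVK.
  exact: sgM.
- rewrite /mkset; have -> : g * h^-1 * g^-1 = (g * h * g^-1)^-1.
    by rewrite !invgM invgK mulgA.
  exact: sgV.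
Qed.

Lemma monolith_normal : normalised monolith setT.
Proof.
move=> g h _ Hh; apply: (Hh [set m | monolith (g * m * g^-1)]).
  exact: conj_subgroup monolith_subgroup.
move=> _ [k [f [D [cD fD ->]]]]; apply: monolith_gen; exists (g * k), f, D.
by split=> //; rewrite invgM !mulgA.
Qed.

(** An automorphism that fixes [F] and a vertex of [D] preserves [D].  It is the
product of its restriction to [D], which fixes any other component, and of its
restriction to the other components, which fixes [D]. *)
Lemma pstab_monolith D w : component F D -> D w -> pstab (w |` F) `<=` monolith.
Proof.
move=> cD Dw g gF; have [_ DF Dcl _] := cD.
have tD : translate g D = D.
  rewrite -{2}(translate1 D); apply: (translate_eq cD Dw) => [v Fv|].
    by rewrite (gF v) //; right.
  by rewrite (gF w) //; left.
have gD u : D (g u) <-> D u by rewrite -{1}tD translateE.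
have [g1 [g1D g1N]] := @glue X (fun=> g) (fun i => if i is 0 then D else set0)
  ltac:(by move=> [|i] [|j] u) ltac:(by move=> [|i] [|j] u v)
  ltac:(by move=> [|i] u; [exact: gD|])
  ltac:(by move=> [|i] u v // Du uv NDv; apply: gF; right; apply: contrapT => NFv;
        apply: NDv; exact: Dcl Du uv NFv).
have {}g1D u : D u -> g1 u = g u := g1D 0%N u.
have {}g1N u : ~ D u -> g1 u = u by move=> NDu; apply: g1N => -[|i []].
have [D' [cD' D'D _ _]] := sep_four sepF D D D.
rewrite -(mulgVK g1 g).
apply: (sgM monolith_subgroup).
  apply: (monolith_rist cD) => v NDv; rewrite aut_mulE.
  case: (pselect (D v)) => [Dv|NDv'].
    have DVv : D (g^-1 v) by rewrite -gD aut_invKV.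
    have -> : g1^-1 v = g^-1 v by rewrite -{1}(aut_invKV g v) -g1D // aut_invK.
    by rewrite aut_invKV.
  have Fv : F v by apply: contrapT => NFv; apply: NDv.
  by rewrite -{1}(g1N v NDv') aut_invK (gF v) //; right.
apply: (monolith_rist cD') => v ND'v; apply: g1N => Dv; apply: ND'v; split.
  by move=> D'v; apply: D'D; exact: component_eq cD' cD D'v Dv.
exact: DF.
Qed.

Lemma monolith_neq1 : exists2 h, monolith h & h <> 1.
Proof.
have [D [cD _ _ _]] := sep_four sepF set0 set0 set0; have [[w Dw] _ _ _] := cD.
have [|g gS g1] := pstab_nontrivial Xlf Xconn sepF Xprim (S := w |` F).
  by rewrite finite_setU; split; [exact: finite_set1|exact: sep_finite sepF].
by exists g => //; exact: (pstab_monolith cD Dw).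
Qed.

Lemma monolith_vtransitive : vtransitive monolith.
Proof.
exact (normal_vtransitive Xprim monolith_subgroup monolith_normal monolith_neq1).
Qed.

Section Normal.
Variable N : set (aut X).
Hypotheses (sN : is_subgroup N) (nN : normalised N monolith).
Hypothesis (N1 : exists2 n, N n & n <> 1).

Let nNV h n : monolith h -> N n -> N (h^-1 * n * h).
Proof.
move=> Hh Nn; have := nN (sgV monolith_subgroup Hh) Nn.
by rewrite invgK.
Qed.

(** A conjugate of a nontrivial element is an arrow, from [c] to [d] say; its
conjugate by an arrow from [b] to a component other than [c] and [d] is a loop at
[b], and the conjugators are available in the monolith. *)
Lemma normal_loop b : component F b -> exists2 n, N n & arrow F b b n.
Proof.
move=> cb; have [n1 Nn1 n11] := N1.
have [h Hh hF] := displacement_move Xlf Xconn sepF Xprim monolith_vtransitive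
  n11 (sep_finite sepF).
have [c [d na]] := moved_arrow sepF hF.
have [a [ca ac ad _]] := sep_four sepF c d d.
have [w Hw wa] := normal_arrow_ex Xlf Xconn sepF Xprim monolith_subgroup
  monolith_normal monolith_vtransitive cb ca.
exists (w^-1 * (h^-1 * n1 * h) * w); first by do 2 apply: nNV => //.
exact: (arrow_conj Xconn sepF wa na ac ad).
Qed.

(** A loop at [b] followed by a loop at [c]. *)
Lemma normal_arrow b c : component F b -> component F c -> b <> c ->
  exists2 n, N n & arrow F b c n.
Proof.
move=> cb cc bc; have [m Nm ma] := normal_loop cb; have [n Nn na] := normal_loop cc.
by exists (n * m); [exact: sgM|exact: (arrow_comp Xconn sepF ma na bc)].
Qed.

(** Tits' commutator argument.  An arrow [q] in [N] from [D] to [y] conjugates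
[f] to an element [f'] supported on [y].  Let [n] in [N] be an arrow from [a] to
[b], both different from [y].  The images of [y] under the powers of [n] are
disjoint and non-adjacent, as all but the first lie in [b].  So the conjugates of
[f'] by the powers of [n] have a common product [h]; it fixes [a], hence lies in
the monolith and normalises [N].  Conjugation by [n] removes the first factor of
the product, and [f'] is the commutator of [h] and [n]. *)
Lemma rist_normal D f : component F D -> rist (off D) f -> N f.
Proof.
move=> cD fD.
have [y [cy yD _ _]] := sep_four sepF D D D.
have [a [ca ay _ _]] := sep_four sepF y y y.
have [b [cb by_ ba _]] := sep_four sepF y a a.
have [q Nq qa] := normal_arrow cD cy (nesym yD).
have [n Nn na] := normal_arrow ca cb (nesym ba).
have [_ yF ycl _] := cy; have [_ bF _ _] := cb.
pose f' := q * f * q^-1.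
have f'y : rist y f'.
  move=> v NDv; rewrite !aut_mulE fD ?aut_invKV // => -[NDq NFq]; apply: NDv.
  have [E cE Eq] := component_ex NFq; rewrite -(aut_invKV q v).
  by apply: (arrow_mapC Xconn sepF qa cE) => // ED; apply: NDq; rewrite -ED.
have f'E : f' = q * f * q^-1 by [].
clearbody f'; pose Y i := translate (n ^+ i) y.
pose fs i := n ^+ i * f' * (n ^+ i)^-1.
have fsY i : rist (Y i) (fs i) by exact: rist_conj.
have Yb i u : Y i.+1 u -> b u.
  move=> Yu; rewrite -(aut_invKV (n ^+ i.+1) u).
  by apply: (arrow_mapC Xconn sepF (arrow_exp Xconn sepF i na ba) cy) => // /esym.
have YD i j u : Y (i + j)%N u = Y j ((n ^+ i)^-1 u).
  by rewrite /Y expgnDr translateM.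
have Y0 u : Y 0%N u = y u by rewrite /Y expg0 translate1.
have far i j u v : (i < j)%N -> Y i u -> Y j v -> u = v \/ adj u v -> False.
  move=> ij; rewrite -[i]addn0 YD Y0 => yu.
  have -> : j = (i + (j - i).-1.+1)%N by lia.
  rewrite YD => /Yb bv uv; apply: by_.
  apply: (component_eq cb cy bv); case: uv => [<-//|uv].
  apply: (ycl _ _ yu); last exact: bF.
  by rewrite aut_adj.
have far' i j u v : Y i u -> Y j v -> u = v \/ adj u v -> i = j.
  move=> Yu Yv uv; apply/eqP; rewrite eqn_leq; apply/andP; split; rewrite leqNgt.
    apply/negP => ji; apply: far ji Yv Yu _.
    by case: uv => [->|/adj_sym]; [left|right].
  by apply/negP => ij; exact: far ij Yu Yv uv.
have [h [hY hN]] := @glue X fs Y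
  ltac:(by move=> i j u Yu Yv; apply: far' Yu Yv _; left)
  ltac:(by move=> i j u v Yu Yv uv; apply: far' Yu Yv _; right)
  ltac:(by move=> i u; exact: rist_stable)
  ltac:(by move=> i u v _ _; exact: fsY).
have Hh : monolith h.
  apply: (monolith_rist ca) => v NOv; apply: hN => -[|i]; last first.
    move=> /Yb bv; apply: NOv; split=> [av|]; last exact: bF.
    by apply: ba; exact: component_eq cb ca bv av.
  rewrite Y0 => yv; apply: NOv; split=> [av|]; last exact: yF.
  by apply: ay; exact: component_eq ca cy av yv.
have YS i u : Y i (n^-1 u) = Y i.+1 u.
  by rewrite -add1n YD expg1.
have f'h : f' * (n * h * n^-1) = h.
  apply: autP => v; rewrite !aut_mulE.
  case: (pselect (exists i, Y i.+1 v)) => [[i Yv]|NY].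
    have -> : n (h (n^-1 v)) = fs i.+1 v.
      rewrite (hY i) ?YS // /fs expgS.
      by rewrite invgM !aut_mulE.
    rewrite (hY i.+1) //; apply: f'y; rewrite -Y0 => yv.
    have Yv' : Y i.+1 (fs i.+1 v) by apply/rist_stable.
    by have := far' 0%N i.+1 _ _ yv Yv' (or_introl erefl).
  rewrite (hN (n^-1 v)); last by move=> i; rewrite YS => Yv; apply: NY; exists i.
  rewrite aut_invKV; case: (pselect (y v)) => [yv|Nyv].
    by rewrite (hY 0%N) ?Y0 // /fs expg0 invg1 mul1g mulg1.
  rewrite (f'y v Nyv) hN // => -[|i] Yv; first by apply: Nyv; rewrite -Y0.
  by apply: NY; exists i.
have Nf' : N f'.
  have := congr1 (fun k => k * (n * h * n^-1)^-1) f'h.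
  rewrite mulgK => ->; rewrite !invgM invgK !mulgA.
  by apply: (sgM sN); [exact: nN|exact: sgV].
have -> : f = q^-1 * f' * q by rewrite f'E !mulgA mulVg mul1g -mulgA mulVg mulg1.
by apply: (sgM sN) => //; apply: (sgM sN) => //; exact: sgV.
Qed.

End Normal.

(** A generator of the monolith belongs to [N] if the corresponding element of a
rigid stabiliser belongs to a conjugate of [N], and this conjugate is again
normalised by the monolith. *)
Lemma monolith_simple N : is_subgroup N -> normalised N monolith ->
  (exists2 n, N n & n <> 1) -> monolith `<=` N.
Proof.
move=> sN nN [n Nn n1] h; apply=> // _ [g [f [D [cD fD ->]]]].
apply: (@rist_normal [set m | N (g * m * g^-1)] _ _ _ D f cD fD).
- exact: conj_subgroup.
- move=> k m Hk Nm.
  have := nN _ _ (monolith_normal Logic.I Hk : monolith (g * k * g^-1)) Nm.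
  by rewrite /mkset !invgM !invgK !mulgA !mulgVK.
- exists (g^-1 * n * g); first by rewrite /mkset !mulgA mulgV mul1g mulgK.
  move=> e; apply: n1; have : g * (g^-1 * n * g) * g^-1 = 1 by rewrite e mulg1 mulgV.
  by rewrite !mulgA mulgV mul1g mulgK.
Qed.

Lemma simple_open_finite_index : exists H : set (aut X),
  [/\ subgroup H, open H, topologically_simple H & finite_index H].
Proof.
have [D [cD _ _ _]] := sep_four sepF set0 set0 set0; have [[w Dw] _ _ _] := cD.
have fS : finite_set (w |` F).
  by rewrite finite_setU; split; [exact: finite_set1|exact: sep_finite sepF].
have sH := monolith_subgroup; have SH := pstab_monolith cD Dw.
have agree g h : (forall v, (w |` F) v -> g v = h v) -> monolith (g^-1 * h).
  by move=> gh; apply: SH => v Sv; rewrite aut_mulE -gh // aut_invK.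
exists monolith; split.
- split; first by rewrite inE; exact: (sg1 sH).
  move=> g h; rewrite !inE => Hg Hh.
  by apply: (sgM sH) => //; exact: (sgV sH).
- rewrite openE => g Hg; apply/aut_nbhsP; exists (w |` F) => // h hg.
  have -> : h = g * (g^-1 * h) by rewrite mulgA mulgV mul1g.
  by apply: (sgM sH) => //; apply: agree => v Sv; rewrite hg.
- move=> N [NB NV] [NH nN] _.
  have sN : is_subgroup N.
    have N1 : N 1 by rewrite -inE.
    have NVg g : N g -> N g^-1.
      by move=> Ng; rewrite -inE -[g^-1]mul1g; apply: NV; rewrite inE.
    split=> // g h Ng Nh; rewrite -inE -[h]invgK; apply: NV; rewrite inE //.
    exact: NVg.
  case: (pselect (exists2 n, N n & n <> 1)) => [N1|N1]; [right|left].
    apply/seteqP; split=> //; apply: monolith_simple => // h n Hh Nn.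
    by have := nN h^-1 n (sgV sH Hh) Nn; rewrite conjgE invgK mulgA.
  apply/seteqP; split=> [n Nn|_ ->]; last exact: (sg1 sN).
  by apply: contrapT => n1; apply: N1; exists n.
(* By transitivity each coset has a representative that fixes [x0]. *)
- pose phi (g : aut X) := [set g * h | h in monolith].
  have phiM g h : monolith h -> phi (g * h) = phi g.
    move=> Hh; apply/seteqP; split=> _ [k Hk <-].
      by exists (h * k); [exact: (sgM sH)|rewrite mulgA].
    exists (h^-1 * k); first by apply: (sgM sH) => //; exact: (sgV sH).
    by rewrite -mulgA (mulgA h) mulgV mul1g.
  apply: (sub_finite_set _ (finite_im_aut Xlf Xconn x0 (phi := phi) fS
    (finite_set1 x0) _)).
    move=> _ [g _ <-]; have [h Hh hx] := monolith_vtransitive x0 (g^-1 x0).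
    exists (g * h); last exact: phiM.
    by rewrite /mkset aut_mulE hx aut_invKV.
  move=> g h gh; rewrite -(phiM g (g^-1 * h)); last exact: agree.
  by rewrite mulgA mulgV mul1g.
Qed.

End Simplicity.


(** * From ends to a separator *)

Section Rays.
Variable X : graph.
Implicit Types (r s t : nat -> X) (S D Q : set X).

Definition tail_in D r := exists n, forall i, (n <= i)%N -> D (r i).

Lemma ray_leaves r S : injective r -> finite_set S ->
  exists n, forall i, S (r i) -> (i < n)%N.
Proof.
move=> rinj fS.
have /choice[b bP] v : exists n, forall i, r i = v -> (i < n)%N.
  case: (pselect (exists i, r i = v)) => [[i <-]|N].
    by exists i.+1 => j /rinj ->.
  by exists 0%N => i rv; case: N; exists i.
have [n nP] := finite_bound b fS.
by exists n => i Si; apply: leq_trans (nP _ Si); exact: bP.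
Qed.

Lemma ray_tail r S : is_ray r -> finite_set S ->
  exists2 D, component S D & tail_in D r.
Proof.
move=> [rinj radj] fS; have [n nP] := ray_leaves rinj fS.
have NS i : (n <= i)%N -> ~ S (r i) by move=> ni /nP; rewrite ltnNge ni.
have [D cD Dn] := component_ex (NS n (leqnn n)).
exists D => //; exists n => i /subnKC <-.
have [_ _ Dcl _] := cD.
elim: (i - n)%N => [|k IH]; first by rewrite addn0.
rewrite addnS; apply: (Dcl _ _ IH); first exact: radj.
by apply: NS; lia.
Qed.

Lemma tail_in_eq D E S r : component S D -> component S E ->
  tail_in D r -> tail_in E r -> D = E.
Proof.
move=> cD cE [n Dn] [m Em].
apply: (component_eq cD cE (u := r (n + m)%N)).
  by apply: Dn; exact: leq_addr.
by apply: Em; exact: leq_addl.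
Qed.

Lemma tail_in_infinite D r : injective r -> tail_in D r -> infinite_set D.
Proof.
move=> rinj [n Dn] fD; have [m mP] := ray_leaves rinj fD.
have := mP (n + m)%N; rewrite ltnNge leq_addl => H.
by have : false by apply: H; apply: Dn; exact: leq_addr.
Qed.

(** No finite set separates the two rays.  This characterises equivalence of
rays and makes its transitivity evident. *)
Definition together r s := forall S, finite_set S ->
  exists D, [/\ component S D, tail_in D r & tail_in D s].

Lemma together_trans r s t : together r s -> together s t -> together r t.
Proof.
move=> rs st S fS; have [D [cD Dr Ds]] := rs S fS.
have [E [cE Es Et]] := st S fS.
by exists D; split=> //; rewrite (tail_in_eq cD cE Ds Es).
Qed.

Lemma together_sym r s : together r s -> together s r.
Proof. by move=> rs S /rs[D [? ? ?]]; exists D. Qed.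

Lemma meets_together r t : is_ray r -> is_ray t ->
  infinite_set (range t `&` range r) -> together r t.
Proof.
move=> rr rt inf S fS.
have [D cD Dr] := ray_tail rr fS; have [E cE Et] := ray_tail rt fS.
suff DE : D = E by exists D; split=> //; rewrite DE.
have [n Dn] := Dr; have [m Em] := Et.
have fT : finite_set ([set r i | i in `I_n] `|` [set t i | i in `I_m]).
  by rewrite finite_setU; split; apply: finite_image; exact: finite_II.
have [_ [[[i _ <-] [j _ tr]] NT]] := infinite_setN0 (infinite_setD inf fT).
apply: (component_eq cD cE (u := t i)).
  rewrite -tr; apply: Dn; rewrite leqNgt; apply/negP => jn; apply: NT.
  by left; exists j.
apply: Em; rewrite leqNgt; apply/negP => im; apply: NT.
by right; exists i.
Qed.

Lemma ray_equiv_together r s : is_ray r -> is_ray s ->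
  ray_equiv r s -> together r s.
Proof.
move=> rr rs [t [rt tr ts]].
by apply: together_trans (meets_together rr rt tr) _;
  apply: together_sym; exact: meets_together rs rt ts.
Qed.

Definition spath m (p : nat -> X) :=
  (forall i, (i < m)%N -> adj (p i) (p i.+1)) /\
  (forall i j, (i <= m)%N -> (j <= m)%N -> p i = p j -> i = j).

(** The set of vertices reached by injective paths is closed under adjacency: a
neighbour that is already on the path is reached by cutting the path there. *)
Lemma spath_ex Q u v : gconn Q -> Q u -> Q v -> exists m p,
  [/\ spath m p, p 0%N = u, p m = v & forall i, (i <= m)%N -> Q (p i)].
Proof.
move=> cQ Qu; move: v.
apply: (cQ (fun v => exists m p,
  [/\ spath m p, p 0%N = u, p m = v & forall i, (i <= m)%N -> Q (p i)])).
  exists u => //; exists 0%N, (fun=> u); split=> //; split=> // i j.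
  by rewrite !leqn0 => /eqP-> /eqP->.
move=> v w [m [p [[padj pinj] p0 pm pQ]]] Qv Qw vw.
case: (pselect (exists2 i, (i <= m)%N & p i = w)) => [[i im pw]|N].
  exists i, p; split=> //; last by move=> j ji; apply: pQ; exact: leq_trans ji im.
  split=> [j ji|j k ji ki]; first by apply: padj; exact: leq_trans ji im.
  by apply: pinj; [exact: leq_trans ji im|exact: leq_trans ki im].
exists m.+1, (fun i => if (i <= m)%N then p i else w); split.
- split=> [i im|i j im jm].
    case: (leqP i.+1 m) => [im1|mi]; first by rewrite (ltnW im1); exact: padj.
    have -> : i = m by lia.
    by rewrite leqnn pm.
  case: (leqP i m) => mi; case: (leqP j m) => mj.
  + exact: pinj.
  + by move=> pw; case: N; exists i.
  + by move=> pw; case: N; exists j.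
  + by move=> _; lia.
- by [].
- by rewrite ltnn.
- by move=> i _; case: leqP => [/pQ|].
Qed.

(** A finite path that ends on [r] and can be continued along it. *)
Definition zigzag r (st : nat * (nat -> X)) :=
  spath st.1 st.2 /\
  exists2 j, st.2 st.1 = r j &
    forall k i, (j < k)%N -> (i <= st.1)%N -> st.2 i <> r k.

Definition extends (st st' : nat * (nat -> X)) :=
  (st.1 < st'.1)%N /\ forall i, (i <= st.1)%N -> st'.2 i = st.2 i.

(** The path avoids the next vertex of [r] and its whole tail, which lies in the
same component of the complement of the path as a tail of [s]. *)
Lemma zigzag_extend r s st : is_ray r -> is_ray s -> together r s ->
  zigzag r st -> exists2 st', extends st st' & zigzag s st'.
Proof.
case: st => n t [rinj radj] [sinj sadj] rs [/= [tadj tinj] [j tn tr]].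
pose S := [set t i | i in `I_n.+1].
have fS : finite_set S by apply: finite_image; exact: finite_II.
have [D [cD [n1 Dr] [m0 Ds]]] := rs S fS.
have [_ DS Dcl Dc] := cD.
have St i : (i <= n)%N -> S (t i) by move=> im; exists i.
have Drj : D (r j.+1).
  have back k : D (r (j + k.+2)%N) -> D (r (j + k.+1)%N).
    move=> Dk; apply: (Dcl _ _ Dk); first by rewrite addnS; apply: adj_sym; exact: radj.
    by move=> [i /= im ti]; apply: (tr (j + k.+1)%N i) => //; lia.
  have : D (r (j + n1.+1)%N) by apply: Dr; lia.
  by elim: n1 {Dr} => [|k IH]; [rewrite addn1|move=> /back/IH].
have [m [p [[padj pinj] p0 pm pD]]] := spath_ex Dc Drj (Ds _ (leqnn m0)).
(* The path from [r] to [s] is cut at the vertex that is farthest along [s]. *)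
have fp : finite_set [set p i | i in `I_m.+1] by apply: finite_image; exact: finite_II.
have [b bP] := ray_leaves sinj fp.
pose P k := `[< exists2 i, (i <= m)%N & p i = s k >].
have exP : exists k, P k by exists m0; apply/asboolP; exists m.
have ubP k : P k -> (k <= b)%N.
  by move=> /asboolP[i im pi]; apply/ltnW/bP; exists i.
case: (ex_maxnP exP ubP) => j' /asboolP[i0 i0m pi0] maxj'.
have m0j' : (m0 <= j')%N by apply: maxj'; apply/asboolP; exists m.
exists (n.+1 + i0, fun i => if (i <= n)%N then t i else p (i - n.+1)%N)%N.
  by split=> /= [|i ->//]; lia.
have sep i k : (i <= n)%N -> (k <= m)%N -> t i <> p k.
  by move=> im km tp; apply: (DS (p k)); [exact: pD|rewrite -tp; exact: St].
split; first split=> /=.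
- move=> i im; case: (leqP i.+1 n) => [in1|ni].
    by rewrite (ltnW in1); exact: tadj.
  case: (leqP i n) => [iln|nlti].
    have -> : i = n by lia.
    by rewrite subnn p0 tn; exact: radj.
  by rewrite subSn //; apply: padj; lia.
- move=> i k im km; case: (leqP i n) => iln; case: (leqP k n) => kln.
  + exact: tinj.
  + by move=> /sep; case=> //; lia.
  + by move=> /esym/sep; case=> //; lia.
  + move=> /pinj H; suff : (i - n.+1 = k - n.+1)%N by lia.
    by apply: H; lia.
- exists j' => /=.
    by rewrite ltnNge leq_addr /= addKn.
  move=> k i j'k im; case: leqP => [iln ti|nlti pk].
    by apply: (DS (s k)); [apply: Ds; lia|rewrite -ti; exact: St].
  have : (k <= j')%N by apply: maxj'; apply/asboolP; exists (i - n.+1)%N => //; lia.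
  by lia.
Qed.

(** Rays that no finite set separates are joined by a ray zigzagging between
them. *)
Lemma together_ray_equiv r s : is_ray r -> is_ray s -> together r s ->
  ray_equiv r s.
Proof.
move=> rr rs trs; pose rho (b : bool) := if b then s else r.
have /choice[e eP] (x : bool * (nat * (nat -> X))) : exists st',
    zigzag (rho x.1) x.2 -> extends x.2 st' /\ zigzag (rho (~~ x.1)) st'.
  case: (pselect (zigzag (rho x.1) x.2)) => [zx|Nzx]; last by exists x.2.
  suff [st' ? ?] : exists2 st', extends x.2 st' & zigzag (rho (~~ x.1)) st'.
    by exists st'.
  by case: x zx => [[] st] /= zx; apply: zigzag_extend zx => //; exact: together_sym.
pose st := fix st k := if k is k'.+1 then e (odd k', st k') else (0%N, fun=> r 0%N).
have stz k : zigzag (rho (odd k)) (st k).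
  elim: k => [|k IH] /=; last by have [] := eP (odd k, st k) IH.
  split; first by split=> // i j; rewrite /= !leqn0 => /eqP-> /eqP->.
  by exists 0%N => // k i k0 _ /(rr.1) k00; rewrite -k00 in k0.
have ste k : extends (st k) (st k.+1) by have [] := eP (odd k, st k) (stz k).
have stn k : (k <= (st k).1)%N.
  by elim: k => [|k IH] //; have [kS _] := ste k; exact: leq_ltn_trans IH kS.
have stmono k d : ((st k).1 <= (st (k + d)).1)%N.
  elim: d => [|d IH]; first by rewrite addn0.
  by rewrite addnS; have [/ltnW kS _] := ste (k + d)%N; exact: leq_trans IH kS.
have stE k l i : (k <= l)%N -> (i <= (st k).1)%N -> (st l).2 i = (st k).2 i.
  move=> /subnKC <- ik; elim: (l - k)%N => [|d IH]; first by rewrite addn0.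
  rewrite addnS -IH; have [_ ->//] := ste (k + d)%N.
  exact: leq_trans ik (stmono _ _).
pose t i := (st i).2 i.
have tE i k : (i <= (st k).1)%N -> t i = (st k).2 i.
  move=> ik; rewrite /t; case: (leqP i k) => [/stE->//|/ltnW ki].
  by rewrite (stE k).
have tray : is_ray t.
  split=> [i j|i].
    have [[_ inj] _] := stz (i + j)%N; have := stn (i + j)%N => ij.
    rewrite (tE i (i + j)%N) ?(tE j (i + j)%N); [|by lia..].
    by apply: inj; lia.
  have [[padj _] _] := stz i.+1; have := stn i.+1 => ij.
  by rewrite (tE i i.+1) ?(tE i.+1 i.+1) //; [apply: padj|]; lia.
have tinf b : infinite_set (range t `&` range (rho b)).
  pose u k := t (st (k.*2 + b)%N).1.
  apply: (@sub_infinite_set _ (range u)).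
    move=> _ [k _ <-]; split; first by exists (st (k.*2 + b)%N).1.
    have [_ [j tj _]] := stz (k.*2 + b)%N.
    exists j => //; rewrite /u (tE _ (k.*2 + b)%N) // tj.
    by rewrite oddD odd_double oddb.
  have uinj : injective u.
    move=> k l /(tray.1); have lt c d : (c < d)%N -> ((st c).1 < (st d).1)%N.
      move=> cd; have [H _] := ste c; apply: leq_trans H _.
      by rewrite -(subnKC cd); exact: stmono.
    move=> ekl; apply/eqP; rewrite eqn_leq; apply/andP; split; rewrite leqNgt;
      apply/negP => kl.
      have /lt : (l.*2 + b < k.*2 + b)%N by lia.
      by rewrite ekl ltnn.
    have /lt : (k.*2 + b < l.*2 + b)%N by lia.
    by rewrite ekl ltnn.
  move=> fu; apply: infinite_nat.
  by rewrite -(eq_finite_set (inj_card_eq (A := setT) (fun k l _ _ => @uinj k l))).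
by exists t; split=> //; [exact: (tinf false)|exact: (tinf true)].
Qed.

End Rays.

Section Absorb.
Variable X : graph.
Hypothesis Xlf : locally_finite X.
Hypothesis Xconn : graph_connected X.

(** [F] is the ball together with its finite components.  Each of these contains
one of the finitely many neighbours of the ball, so [F] is finite; and the
infinite components of the complement are not affected. *)
Lemma absorb n (x0 : X) : exists F : set X,
  [/\ gball n x0 `<=` F, finite_set F, gconn F,
     forall D, component F D -> infinite_set D &
     forall D, component (gball n x0) D -> infinite_set D -> component F D].
Proof.
set B := gball n x0.
have Bx0 : B x0 := gball_center _ _.
pose F : set X := [set v | forall D, component B D -> infinite_set D -> ~ D v].
have BF : B `<=` F by move=> v Bv D [_ DB _ _] _ /DB.
have FP v : F v -> B v \/ exists D, [/\ component B D, finite_set D & D v].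
  move=> Fv; case: (pselect (B v)) => [Bv|NBv]; [by left|right].
  have [D cD Dv] := component_ex NBv; exists D; split=> //.
  by apply: contrapT => /(Fv D cD).
have cF D : component B D -> infinite_set D -> component F D.
  move=> cD iD; have [D0 DB Dcl Dc] := cD; split=> //.
    by move=> u Du /(_ D cD iD).
  by move=> u v Du uv NFv; apply: (Dcl u) => // /BF.
exists F; split=> //.
- pose G u : set X := [set v | exists D, [/\ component B D, finite_set D, D u & D v]].
  apply: (@sub_finite_set _ _ (B `|` \bigcup_(u in gball n.+1 x0) G u)).
    move=> v /FP[Bv|[D [cD fD Dv]]]; first by left.
    have [u [w [Du Bw uw]]] := component_adj Xconn cD (ex_intro _ x0 Bx0).
    right; exists u; last by exists D.
    by right; exists w => //; exact: adj_sym.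
  rewrite finite_setU; split; first exact: gball_finite.
  apply: bigcup_finite => [|u _]; first exact: gball_finite.
  case: (pselect (exists D, [/\ component B D, finite_set D & D u])) =>
    [[D [cD fD Du]]|N].
    apply: sub_finite_set fD => v [E [cE _ Eu Ev]].
    by rewrite (component_eq cD cE Du Eu).
  apply: sub_finite_set (finite_set0 X) => v [D [cD fD Du _]].
  by apply: N; exists D.
- have hub v : F v -> exists Q, [/\ gconn Q, Q `<=` F, B `<=` Q & Q v].
    move=> /FP[Bv|[D [cD fD Dv]]].
      by exists B; split=> //; exact: gball_gconn.
    exists (D `|` B); split; last by left.
    + by apply: component_gconnU => //; [exact: gball_gconn|exists x0].
    + move=> w [Dw|/BF//] E cE iE Ew; apply: iE.
      by rewrite -(component_eq cD cE Dw Ew).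
    + by move=> w Bw; right.
  move=> A [w Fw Aw] Acl v Fv.
  have spread Q u : gconn Q -> Q `<=` F -> Q u -> A u -> Q `<=` A.
    move=> cQ QF Qu Au; apply: cQ; first by exists u.
    by move=> a b Aa Qa Qb; apply: Acl => //; exact: QF.
  have [Q [cQ QF BQ Qw]] := hub w Fw; have [Q' [cQ' QF' BQ' Qv]] := hub v Fv.
  apply: (spread Q' x0) => //; first exact: BQ'.
  by apply: (spread Q w) => //; exact: BQ.
- move=> D cD; have [[u Du] DF _ _] := cD.
  have [E [cE iE Eu]] : exists E, [/\ component B E, infinite_set E & E u].
    apply: contrapT => N; apply: (DF u Du) => E cE iE Eu; apply: N.
    by exists E.
  by rewrite (component_eq cD (cF E cE iE) Du Eu).
Qed.

(** At least four ends are represented by rays that are pairwise separated by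
finite sets.  Their tails lie in different infinite components of the complement
of a ball that contains these sets. *)
Lemma separator_ex : infinite_set (ends X) ->
  exists (F : set X) (x0 : X), separator F x0.
Proof.
move=> iE; have [B BE B4] := infinite_set_fset 4 iE.
have endP E : ends X E -> exists2 r, is_ray r & E = [set s | is_ray s /\ ray_equiv r s].
  by move=> [r rr <-]; exists r.
have [E0 /endP[r0 rr0 _]] := infinite_setN0 iE.
have /choice[rho rhoP] E : exists r, is_ray r /\
    (ends X E -> E = [set s | is_ray s /\ ray_equiv r s]).
  case: (pselect (ends X E)) => [/endP[r rr Er]|NE]; first by exists r.
  by exists r0.
have rho_ray E : is_ray (rho E) := (rhoP E).1.
have rho_inj E E' : ends X E -> ends X E' -> together (rho E) (rho E') -> E = E'.
  move=> eE eE' tEE'; rewrite ((rhoP E).2 eE) ((rhoP E').2 eE').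
  apply/seteqP; split=> s [rs es]; split=> //.
    apply: together_ray_equiv => //.
    apply: together_trans (together_sym tEE') _; exact: ray_equiv_together.
  apply: together_ray_equiv => //.
  by apply: together_trans tEE' _; exact: ray_equiv_together.
have /choice[S SP] (p : set (nat -> X) * set (nat -> X)) : exists S : set X,
    finite_set S /\ (ends X p.1 -> ends X p.2 -> p.1 <> p.2 ->
      forall D, component S D -> tail_in D (rho p.1) -> ~ tail_in D (rho p.2)).
  case: (pselect (together (rho p.1) (rho p.2))) => [t12|N].
    by exists set0; split=> // e1 e2; case; exact: rho_inj.
  have /existsNP[S NS] : ~ forall S : set X, finite_set S -> exists D,
    [/\ component S D, tail_in D (rho p.1) & tail_in D (rho p.2)] := N.
  exists S; split; first by apply: contrapT => NfS; apply: NS.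
  by move=> _ _ _ D cD D1 D2; apply: NS => fS; exists D.
pose T := \bigcup_(p in [set` B] `*` [set` B]) S p.
have fT : finite_set (T `|` [set r0 1%N]).
  rewrite finite_setU; split; last exact: finite_set1.
  apply: bigcup_finite => [|p _]; last exact: (SP p).1.
  by apply: finite_setX; exact: finite_fset.
have [n Tn] := finite_sub_gball Xconn (r0 0%N) fT.
set x0 := r0 0%N in Tn.
have [F [BF fF cF Finf Fcomp]] := absorb n x0.
exists F, x0; split=> //.
- by apply: BF; exact: gball_center.
- exists (r0 1%N); first by apply/BF/Tn; right.
  by move=> /(rr0.1).
have /choice[C CP] E : exists D, component (gball n x0) D /\ tail_in D (rho E).
  by have [D cD Dr] := ray_tail (rho_ray E) (gball_finite Xlf n x0); exists D.
have Cinj : {in B &, injective C}.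
  move=> E E' EB E'B CE; apply: contrapT => NEE'.
  have [cC tC] := CP E; have [_ tC'] := CP E'; rewrite -CE in tC'.
  have [[u Cu] CB _ cc] := cC.
  have ST : S (E, E') `<=` gball n x0.
    by move=> v Sv; apply: Tn; left; exists (E, E').
  have [D cD DC] : exists2 D, component (S (E, E')) D & C E `<=` D.
    have NS v : C E v -> ~ S (E, E') v by move=> Cv /ST; exact: CB.
    have [D cD Du] := component_ex (NS u Cu).
    by exists D => //; exact: gconn_sub_component cD cc NS Cu Du.
  have sub r : tail_in (C E) r -> tail_in D r.
    by move=> [m Cm]; exists m => i mi; apply: DC; exact: Cm.
  by apply: ((SP (E, E')).2 (BE _ EB) (BE _ E'B) NEE' D cD); exact: sub.
move=> a b c; apply: contrapT => N.
have uC : uniq (map C B) by rewrite (map_inj_in_uniq Cinj) fset_uniq.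
have subC : {subset map C B <= [:: a; b; c]}.
  move=> _ /mapP[E EB ->]; have [cC tC] := CP E.
  apply: contrapT => NC; apply: N; exists (C E).
  split; try by move=> e; apply: NC; rewrite e !inE eqxx ?orbT.
  by apply: Fcomp => //; exact: tail_in_infinite (rho_ray E).1 tC.
have := uniq_leq_size uC subC; rewrite size_map /=.
by move=> B3; have := leq_trans B4 B3.
Qed.

End Absorb.

Theorem theorem15 (X : graph) :
  locally_finite X -> graph_connected X -> primitive X ->
  infinite_set (ends X) ->
  exists H : set (aut X),
    [/\ subgroup H, open H, topologically_simple H & finite_index H].
Proof.
move=> Xlf Xconn Xprim /(separator_ex Xlf Xconn)[F [x0 sepF]].
exact: simple_open_finite_index sepF Xprim.
Qed.
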